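(* There exist two numerical constants $c_1, c_2>0$ such that the following holds. Let $\mathcal{T}$ be a rooted tree (locally finite, without leaves) such that $$2\le D_{min}(\mathcal{T}) = \inf_{v\in \mathcal{T}} D(v) \le \sup_{v\in \mathcal{T}} D(v) = D_{max}(\mathcal{T})<\infty$$ and let $\alpha = (\alpha_k)_{k=1}^\infty$ be a sequence of real numbers with $\sum_{k=1}^\infty \alpha_k^2<\infty$. Then the following conditions are equivalent: (1) $M^*(\mathcal{T}, \alpha)$ is almost surely bounded (i.e. $M^*(\mathcal{T},\alpha)<\infty$ almost surely); (2) the following convergence holds: $$\lim_{N\rightarrow\infty}\mathbb{E}\Big[\sup_{n\geq N}\sup_{m\geq 0}\sup_{\xi\in\partial\mathcal{T}}\Big|\sum_{k=n}^{n+m}\alpha_kZ(\pi_k(\xi))\Big|^2\Big]=0;$$ (3) almost surely, the series $X(\mathcal{T}, \alpha; \xi)= \sum_{k=1}^\infty \alpha_k Z(\pi_k(\xi))$ converges uniformly in $\xi \in \partial \mathcal{T}$; (4) the sequence $\alpha$ satisfies $$Q(\alpha) = \sum_{l=0}^\infty \Big( \frac{1}{l+1}\sum_{k=l+1}^\infty \alpha_k^2\Big)^{1/2}<\infty.$$ Moreover, under one of the equivalent conditions (1), (2), (3), (4), the constants $c_1,c_2$ (which are independent of $\mathcal{T}$ and $\alpha$) satisfy $$c_1 \sqrt{\log D_{min}(\mathcal{T})}\cdot Q(\alpha) \le \Big(\mathbb{E}\Big[ \sup_{\xi\in \partial \mathcal{T}} | X(\mathcal{T}, \alpha; \xi)|^2\Big]\Big)^{1/2}\le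 c_2 \sqrt{\log D_{max}(\mathcal{T})} \cdot Q(\alpha)$$ and $$c_1 \sqrt{\log D_{min}(\mathcal{T})}\cdot Q(\alpha) \le \big(\mathbb{E}[M^*(\mathcal{T}, \alpha)^2]\big)^{1/2} \le c_2 \sqrt{\log D_{max}(\mathcal{T})} \cdot Q(\alpha).$$
   Context: $\mathbb{N}=\{1,2,\dots\}$. All rooted trees $\mathcal{T}$ are assumed locally finite and without leaves. The root is denoted $\rho$, $d(\cdot,\cdot)$ is the graph distance, $|v|=d(\rho,v)$, and $\preccurlyeq$ is the natural partial order ($u\preccurlyeq v$ iff $u$ lies on the geodesic from $\rho$ to $v$). For $v\in\mathcal{T}$, $D(v)=\#\{u\in \mathcal{T}: v\preccurlyeq u \text{ and } d(u,v)=1\}$ is the number of children of $v$. A rooted geodesic ray is a sequence $\xi=(\rho,v_1,v_2,\dots)$ of vertices with $v_1\preccurlyeq v_2\preccurlyeq\cdots$ and consecutive vertices at distance 1 (so $|v_n|=n$). The boundary $\partial\mathcal{T}$ is the set of all rooted geodesic rays, and $\pi_n(\xi)=v_n$ for $n\in\mathbb{N}$. $(Z(v))_{v\in\mathcal{T}}$ is a family of independent standard Gaussian $N(0,1)$ random variables. Set $X_n(\mathcal{T},\alpha;\xi)=\sum_{k=1}^n\alpha_kZ(\pi_k(\xi))$ and $M^*(\mathcal{T},\alpha)=\sup_{n\in\mathbb{N}}\sup_{\xi\in\partial\mathcal{T}}|X_n(\mathcal{T},\alpha;\xi)|$. *)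

(* Defs.v *)
From HB Require Import structures.
From mathcomp Require Import all_boot all_order all_algebra finmap.
From mathcomp Require Import all_classical all_reals all_analysis.

Set Implicit Arguments.
Unset Strict Implicit.
Unset Printing Implicit Defensive.

Import Order.TTheory GRing.Theory Num.Theory.
Import numFieldNormedType.Exports.

Local Open Scope classical_set_scope.
Local Open Scope ring_scope.

(* A tree is a simple graph in which any two vertices are joined by exactly one
   simple path; p lists the vertices of the path after u. *)
Record rooted_tree := RootedTree {
  vertex :> choiceType ;
  adj : rel vertex ;
  root : vertex ;
  adj_sym : symmetric adj ;
  adj_irr : irreflexive adj ;
  tree_path : forall u v : vertex,
    exists! p : seq vertex, [/\ path adj u p, last u p = v & uniq (u :: p)] }.

Section rooted_tree.
Variable T : rooted_tree.
Implicit Types u v : T.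

Definition walk u v (p : seq T) : bool := path (@adj T) u p && (last u p == v).

Lemma walk_ex u v : exists n, `[< exists2 p, walk u v p & size p = n >].
Proof.
have [p [[pp lp _] _]] := tree_path u v.
by exists (size p); apply/asboolP; exists p => //; rewrite /walk pp lp eqxx.
Qed.

Definition dist u v : nat := ex_minn (walk_ex u v).

Definition geodesic u v (p : seq T) : Prop := walk u v p /\ size p = dist u v.

Definition tree_le u v : Prop :=
  exists2 p, geodesic (root T) v p & u \in root T :: p.

Definition children v : set T := [set u | tree_le v u /\ dist u v = 1%N].

Definition locally_finite : Prop :=
  forall v, finite_set [set u | @adj T v u].

Definition leafless : Prop := forall v, children v !=set0.

(* fset_set sends infinite sets to fset0, so nb_children is meaningful for
   locally finite trees only. *)
Definition nb_children v : nat := #|` fset_set (children v)|.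

Definition boundary : set (nat -> T) :=
  [set xi | xi 0%N = root T /\
    forall n, tree_le (xi n) (xi n.+1) /\ dist (xi n) (xi n.+1) = 1%N].

End rooted_tree.

Arguments boundary : clear implicits.

Definition Dmin (R : realType) (T : rooted_tree) : \bar R :=
  ereal_inf [set (nb_children v)%:R%:E | v in [set: T]].

Definition Dmax (R : realType) (T : rooted_tree) : \bar R :=
  ereal_sup [set (nb_children v)%:R%:E | v in [set: T]].

Section gaussian_family.
Context {d : measure_display} {Omega : measurableType d} {R : realType}.
Variable P : probability Omega R.

Definition mutually_independent (I : choiceType) (Z : I -> {RV P >-> R}) : Prop :=
  forall (A : {fset I}) (B : I -> set R),
    (forall i, measurable (B i)) ->
    P (\bigcap_(i in [set` A]) (Z i @^-1` B i)) =
    (\prod_(i <- A) P (Z i @^-1` B i))%E.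

Definition standard_gaussian (X : {RV P >-> R}) : Prop :=
  forall B : set R, measurable B -> distribution P X B = normal_prob 0 1 B.

End gaussian_family.

(* Sequences (alpha_k)_{k >= 1} are functions on nat whose value at 0 is never
   used. *)
Section tree_series.
Context {d : measure_display} {Omega : measurableType d} {R : realType}.
Variables (P : probability Omega R) (T : rooted_tree).
Variables (Z : T -> {RV P >-> R}) (alpha : nat -> R).

(* sum of alpha_k Z(pi_k(xi)) over m <= k <= n *)
Definition block (m n : nat) (omega : Omega) (xi : nat -> T) : R :=
  \sum_(m <= k < n.+1) alpha k * Z (xi k) omega.

Definition Xn (omega : Omega) (n : nat) (xi : nat -> T) : R :=
  block 1 n omega xi.

Definition Xinf (omega : Omega) (xi : nat -> T) : R :=
  limn (fun n => Xn omega n xi).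

Definition Mstar (omega : Omega) : \bar R :=
  ereal_sup [set ereal_sup [set `|Xn omega n xi|%:E | xi in boundary T]
            | n in [set n | (1 <= n)%N]].

Definition tail_sup2 (N : nat) (omega : Omega) : \bar R :=
  ereal_sup [set ereal_sup [set ereal_sup
      [set (`|block n (n + m) omega xi| ^+ 2)%:E | xi in boundary T]
            | m in [set: nat]]
            | n in [set n | (1 <= n)%N /\ (N <= n)%N]].

Definition as_bounded : Prop :=
  {ae P, forall omega, (Mstar omega < +oo)%E}.

Definition tails_vanish_in_L2 : Prop :=
  (\int[P]_omega tail_sup2 N omega)%E @[N --> \oo] --> (0%E : \bar R).

Definition as_uniformly_convergent : Prop :=
  {ae P, forall omega, exists f : (nat -> T) -> R,
    {uniform boundary T, Xn omega n @[n --> \oo] --> f}}.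

Definition Xinf_sup2 (omega : Omega) : \bar R :=
  ereal_sup [set (`|Xinf omega xi| ^+ 2)%:E | xi in boundary T].

End tree_series.

Definition Q (R : realType) (alpha : nat -> R) : \bar R :=
  (\sum_(0 <= l <oo)
    sqrte ((l.+1%:R^-1)%:E * \sum_(l.+1 <= k <oo) (alpha k ^+ 2)%:E))%E.

(* Main.v *)
Require Import Defs.
From HB Require Import structures.
From mathcomp Require Import all_boot all_order all_algebra finmap.
From mathcomp Require Import all_classical all_reals all_analysis.
From mathcomp Require Import measurable_realfun.
From mathcomp Require Import ring lra zify.
Set Implicit Arguments.
Unset Strict Implicit.
Unset Printing Implicit Defensive.
Import Order.TTheory GRing.Theory Num.Theory.
Import numFieldNormedType.Exports.
Local Open Scope classical_set_scope.
Local Open Scope ring_scope.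

(** The theorem is read off at the dyadic scales of the tree.  Let
    [b_j ^ 2] be the sum of the squares [alpha_k ^ 2] over the block
    [2 ^ j <= k < 2 ^ (j + 1)], and let [S_J] be the sum over [j < J] of
    [2 ^ (j / 2) * b_j] ([dyadic_sum]).  A direct comparison of series gives
    [S_J <= 2 Q] for all [J], and [Q <= 4 sup_J S_J] ([dyadic_sum_le_Q],
    [Q_le_dyadic_sum]), so that [Q] may be replaced by [S = sup_J S_J].

    Upper bounds.  Up to the end of block [j] there are at most
    [Dmax ^ (2 ^ (j + 1))] vertices, and a partial sum inside the block is a
    centred Gaussian variable of variance at most [b_j ^ 2].  The expected
    square of the largest of them is therefore of order
    [2 ^ j * ln Dmax * b_j ^ 2].  To keep all integrands measurable, this
    maximum is replaced by a sum of exponentials ([envelope]), whose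
    expectation is at most the square of
    [weight j = sqrt (12 ln Dmax) * 2 ^ (j / 2) * b_j].  A ray crosses each
    block once; the Cauchy-Schwarz inequality with these weights bounds all
    increments beyond level [2 ^ J] by a product of the tail of the series of
    weights and a random series whose expectation is at most that tail
    ([chain_bound], [tail_envelope_expectation]).  If [Q] is finite the tail of
    the weights vanishes, whence the convergence in mean square, the almost sure
    uniform convergence and both upper bounds.

    Lower bounds.  The supremum is bounded below by a greedy search that uses
    the blocks of one parity only.  The skipped block leaves room to choose:
    from the vertex where the search stands, at least [Dmin ^ (2 ^ j / 2)]
    descendants can be reached at level [2 ^ j], and from each of them an arm
    is drawn across block [j].  The arms lie in disjoint subtrees, hence are
    independent, and each exceeds [t_j], a multiple of
    [2 ^ (j / 2) * sqrt (ln Dmin) * b_j], with probability at least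
    [tail_cst * Dmin ^ (- 2 ^ j / 2)]: with probability bounded below some
    arm succeeds.  In terms of the Laplace transform at [- theta] of the
    maximum, crossing block [j] gains a factor [exp (- c * theta * t_j)],
    while the skipped levels cost only [exp (theta ^ 2 / 2 * variance)]
    ([block_expectation], [recursion_expectation]).  As the total variance is
    at most [S_J ^ 2], a suitable [theta] yields a small ball estimate: with a
    probability bounded below by a numerical constant, the maximum at level
    [2 ^ J - 1] exceeds a multiple of [sqrt (ln Dmin) * S_J] ([small_ball]).

    Consequently [S] is finite as soon as [M^*] is finite with probability
    one, and the second moments are bounded below; for the limit of the series
    the increments beyond level [2 ^ J] are controlled by the upper bound.
    Finally, convergence of the tails in mean square gives boundedness by
    Markov's inequality, and uniform convergence gives it pointwise, because
    each level is finite.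

    Suprema over the uncountable boundary are not known to be measurable.
    This is harmless, since the integral of a nonnegative function is a
    supremum over the simple functions below it: monotonicity and Markov's
    inequality persist ([ge0_le_integral_any], [markov_any]), and all other
    computations concern finitely or countably many vertices. *)

(** * Levels, ancestors and rays *)

Section tree.
Variable T : rooted_tree.
Implicit Types u v w : T.
Local Notation r := (Defs.root T).

Definition simple_path u v (p : seq T) :=
  [/\ path (@adj T) u p, last u p = v & uniq (u :: p)].

Lemma simple_path_unique u v p q :
  simple_path u v p -> simple_path u v q -> p = q.
Proof.
by move=> hp hq; have [s [_ us]] := tree_path u v; rewrite -(us p hp) -(us q hq).
Qed.

Definition trunk v : seq T := sval (cid (tree_path r v)).

Lemma trunkP v : simple_path r v (trunk v).
Proof. by rewrite /trunk; case: cid => p []. Qed.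

Definition level v := size (trunk v).

(** Reading ancestors off the trunk makes the sum along a branch a function of its
    end vertex, so that finitely many vertices stand for uncountably many rays. *)
Definition anc (k : nat) v : T := nth r (r :: trunk v) k.

Lemma geodesic_simple u v p : geodesic u v p -> simple_path u v p.
Proof.
move=> [/andP[pp /eqP lp] sp]; split => //.
move: lp; case: (shortenP pp) => p' pp' up' sub lp'.
apply: (leq_size_uniq up').
  move=> x; rewrite !inE => /orP[->//|xp']; apply/orP; right; exact: sub.
rewrite /= ltnS sp /dist; case: ex_minnP => m _; apply.
by apply/asboolP; exists p' => //; rewrite /walk pp' lp' eqxx.
Qed.

Lemma adj_neq u v : adj u v -> u != v.
Proof. by apply: contraTneq => ->; rewrite adj_irr. Qed.

Lemma dist1P u v : dist u v = 1%N <-> adj u v.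
Proof.
rewrite /dist; case: ex_minnP => m /asboolP[p /andP[pp lp] <-] min; split.
  by case: p pp lp {min} => [//|x [|//]] /= /andP[+ _] /eqP <-.
move=> auv; apply/eqP; rewrite eqn_leq min/=; last first.
  by apply/asboolP; exists [:: v] => //; rewrite /walk/= auv eqxx.
by case: p lp {pp min} => //= /eqP uv; move: (adj_neq auv); rewrite uv eqxx.
Qed.

Lemma child_adj v u : children v u -> adj v u.
Proof. by move=> [_ /dist1P]; rewrite adj_sym. Qed.

(** A child is reached through its parent: cut at [v], the geodesic to [u] splits
    into two simple paths, which uniqueness identifies with the trunk of [v] and
    the single edge from [v] to [u]. *)
Lemma trunk_child v u : children v u -> trunk u = rcons (trunk v) u.
Proof.
move=> cu; have [[p gp vp] _] := cu; have auv := child_adj cu.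
have sp := geodesic_simple gp.
rewrite (simple_path_unique (trunkP u) sp).
case/splitPl: vp sp => p1 p2 lp1 [].
rewrite cat_path last_cat lp1 -cat_cons cat_uniq => /andP[pp1 pp2] lp2.
move=> /and3P[up1 /hasPn dis up2].
have -> : p1 = trunk v by apply: (@simple_path_unique r v) => //; exact: trunkP.
have -> : p2 = [:: u]; last by rewrite cats1.
apply: (@simple_path_unique v u); split => //=.
  rewrite up2 andbT; apply/negP => /dis /=.
  by rewrite -{1}lp1 mem_last.
- by rewrite auv.
- by rewrite inE adj_neq.
Qed.

Lemma level_root : level r = 0%N.
Proof.
rewrite /level (@simple_path_unique r r (trunk r) [::])//; exact: trunkP.
Qed.

Lemma level_child v u : children v u -> level u = (level v).+1.
Proof. by move=> /trunk_child; rewrite /level => ->; rewrite size_rcons. Qed.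

Lemma anc_level v : anc (level v) v = v.
Proof.
by rewrite /anc /level -[X in nth _ _ X]/(size (r :: trunk v)).-1 nth_last /=; case: (trunkP v).
Qed.

Lemma anc_child v u k : children v u -> (k <= level v)%N -> anc k u = anc k v.
Proof.
move=> cu kv; rewrite /anc (trunk_child cu) -rcons_cons nth_rcons /=.
by rewrite ltnS kv.
Qed.

Lemma anc_inj u j k : (j <= level u)%N -> (k <= level u)%N ->
  anc j u = anc k u -> j = k.
Proof.
have [_ _ un] := trunkP u => ju ku; rewrite /anc => /eqP.
by rewrite nth_uniq// => /eqP.
Qed.

Lemma trunk_anc u k : (k <= level u)%N -> trunk (anc k u) = take k (trunk u).
Proof.
move=> ku; apply: (simple_path_unique (trunkP _)).
have [pp _ un] := trunkP u; split.
- exact: take_path.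
- rewrite /anc -nth_last /= size_takel//.
  by case: k ku => [|k ku]; rewrite ?take0//= nth_take.
- by rewrite -[_ :: _]/(take k.+1 (r :: trunk u)); exact: take_uniq.
Qed.

Lemma level_anc u k : (k <= level u)%N -> level (anc k u) = k.
Proof. by move=> ku; rewrite /level trunk_anc// size_takel. Qed.

Lemma anc_anc u j k : (j <= k)%N -> (k <= level u)%N -> anc j (anc k u) = anc j u.
Proof.
move=> jk ku; rewrite {1}/anc trunk_anc// -[_ :: _]/(take k.+1 (r :: trunk u)).
by rewrite nth_take.
Qed.

Hypothesis lf : locally_finite T.

Lemma finite_children v : finite_set (children v).
Proof. by apply: sub_finite_set (lf v) => u /child_adj. Qed.

Definition kids v : seq T := fset_set (children v).

Lemma kidsP v u : reflect (children v u) (u \in kids v).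
Proof.
rewrite in_fset_set; last exact: finite_children.
by apply: (iffP idP); rewrite inE.
Qed.

Fixpoint desc v m : seq T :=
  if m is m'.+1 then flatten [seq kids w | w <- desc v m'] else [:: v].

Lemma descS v m u : reflect (exists2 w, w \in desc v m & children w u)
  (u \in desc v m.+1).
Proof.
apply: (iffP flattenP) => [[s /mapP[w wd ->] /kidsP uw]|[w wd /kidsP uw]].
  by exists w.
by exists (kids w) => //; apply: map_f.
Qed.

Lemma desc_level v m u : u \in desc v m -> level u = (level v + m)%N.
Proof.
elim: m u => [|m IH] u; first by rewrite inE addn0 => /eqP ->.
by move=> /descS[w /IH lw /level_child ->]; rewrite lw addnS.
Qed.

Lemma desc_anc v m u k : u \in desc v m -> (k <= level v)%N -> anc k u = anc k v.
Proof.
elim: m u => [|m IH] u; first by rewrite inE => /eqP ->.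
move=> /descS[w wv cu] kv; rewrite (anc_child cu) ?(IH w)//.
by rewrite (desc_level wv) (leq_trans kv)// leq_addr.
Qed.

Lemma desc_anc_start v m u : u \in desc v m -> anc (level v) u = v.
Proof. by move=> ud; rewrite (desc_anc ud)// anc_level. Qed.

Lemma desc_trans v m w n u : w \in desc v m -> u \in desc w n ->
  u \in desc v (m + n).
Proof.
move=> wv; elim: n u => [|n IH] u; first by rewrite inE addn0 => /eqP ->.
by move=> /descS[x /IH xv cx]; rewrite addnS; apply/descS; exists x.
Qed.

Lemma uniq_desc v m : uniq (desc v m).
Proof.
elim: m => [//|m]; rewrite /=; elim: (desc v m) => [//|w s IH] /= /andP[ws us].
rewrite cat_uniq IH// andbT; apply/andP; split.
  exact: fset_uniq.
apply/hasPn => x /flattenP[k /mapP[w' w's ->]] /kidsP xw' /=.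
apply/kidsP => xw; move: ws; rewrite -(anc_level w) -(anc_child xw)//.
have := level_child xw; rewrite (level_child xw') => -[<-].
by rewrite (anc_child xw')// anc_level w's.
Qed.

Lemma desc_root_anc u k : u \in desc r (level u) -> (k <= level u)%N ->
  anc k u \in desc r k.
Proof.
move lu : (level u) => n; elim: n u lu => [|n IH] u lu.
  by move=> ud; rewrite leqn0 => /eqP ->; rewrite -{1}lu anc_level.
move=> /descS[y yn cy]; rewrite leq_eqVlt => /orP[/eqP ->|].
  by rewrite -{1}lu anc_level; apply/descS; exists y.
have ly : level y = n by rewrite (desc_level yn) level_root.
by rewrite ltnS => kn; rewrite (anc_child cy) ?ly//; exact: IH.
Qed.

Section count.
Variable R : realType.

Lemma size_desc_ge (D : R) v m : 0 <= D ->
  (forall w, D <= (nb_children w)%:R) -> D ^+ m <= (size (desc v m))%:R.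
Proof.
move=> D0 hD; elim: m => [|m IH]; first by rewrite expr0.
rewrite exprS /= size_flatten /shape -map_comp.
apply: (@le_trans _ _ (D * (size (desc v m))%:R)); first by rewrite ler_wpM2l.
elim: (desc v m) {IH} => [|w s IH]/=; first by rewrite mulr0.
by rewrite -natr1 mulrDr mulr1 addrC natrD lerD//; exact: hD.
Qed.

Lemma size_desc_le (D : R) v m : 0 <= D ->
  (forall w, (nb_children w)%:R <= D) -> (size (desc v m))%:R <= D ^+ m.
Proof.
move=> D0 hD; elim: m => [|m IH]; first by rewrite expr0.
rewrite exprS /= size_flatten /shape -map_comp.
apply: (@le_trans _ _ (D * (size (desc v m))%:R)); last by rewrite ler_wpM2l.
elim: (desc v m) {IH} => [|w s IH]/=; first by rewrite mulr0.
by rewrite -natr1 mulrDr mulr1 addrC natrD lerD//; exact: hD.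
Qed.

End count.

Lemma boundary_child xi n : boundary T xi -> children (xi n) (xi n.+1).
Proof.
by move=> [_ /(_ n)[lxi /dist1P axi]]; split => //; apply/dist1P; rewrite adj_sym.
Qed.

Lemma boundary_desc xi n : boundary T xi -> xi n \in desc r n.
Proof.
move=> bxi; elim: n => [|n IH]; first by case: bxi => ->; rewrite inE.
by apply/descS; exists (xi n) => //; exact: boundary_child.
Qed.

Lemma boundary_level xi n : boundary T xi -> level (xi n) = n.
Proof. by move=> /(boundary_desc n)/desc_level ->; rewrite level_root. Qed.

Lemma boundary_anc xi k n : boundary T xi -> (k <= n)%N -> anc k (xi n) = xi k.
Proof.
move=> bxi; elim: n => [|n IH]; rewrite leq_eqVlt => /orP[/eqP ->|] //.
- by have := anc_level (xi 0%N); rewrite boundary_level.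
- by have := anc_level (xi n.+1); rewrite boundary_level.
- rewrite ltnS => kn; rewrite (anc_child (boundary_child n bxi)) ?IH//.
  by rewrite boundary_level.
Qed.

Hypothesis ll : leafless T.

Definition heir v : T := sval (cid (ll v)).

Lemma heirP v : children v (heir v).
Proof. by rewrite /heir; case: cid. Qed.

Lemma desc_heir v m : iter m heir v \in desc v m.
Proof.
elim: m => [|m IH]; first by rewrite inE.
by apply/descS; exists (iter m heir v) => //; exact: heirP.
Qed.

(** As there are no leaves, a finite branch continues to a ray by following [heir];
    thus a supremum over rays of a function of the vertex of level [n] is a
    maximum over [desc r n]. *)
Lemma boundary_extend n u : u \in desc r n ->
  exists2 xi, boundary T xi & xi n = u.
Proof.
move=> un; pose xi k := if (k <= n)%N then anc k u else iter (k - n) heir u.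
have lu : level u = n by rewrite (desc_level un) level_root.
have xin : xi n = u by rewrite /xi leqnn -{1}lu anc_level.
exists xi => //.
have h k : (n <= k)%N -> xi k = iter (k - n) heir u.
  by rewrite leq_eqVlt => /orP[/eqP<-|nk]; rewrite ?xin ?subnn// /xi leqNgt nk.
split; first by rewrite /xi /= -level_root (desc_anc_start un).
move=> k; suff [? /dist1P] : children (xi k) (xi k.+1).
  by rewrite adj_sym => /dist1P.
have [nk|kn] := leqP n k.
  by rewrite !h ?(leqW nk)// subSn//=; exact: heirP.
rewrite /xi kn (ltnW kn) {xi h xin}.
elim: n u un lu kn => [//|n IH] u /descS[w wn cw] lu; rewrite ltnS => kn.
have lw : level w = n by rewrite (desc_level wn) level_root.
rewrite (anc_child cw) ?lw//; move: kn; rewrite leq_eqVlt => /orP[/eqP ->|kn].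
  by rewrite -{1}lw anc_level -lu anc_level.
by rewrite (anc_child cw) ?lw//; exact: IH.
Qed.

End tree.

(** * Independence of disjoint sets of vertices *)

Section independence.
Context {d : measure_display} {Omega : measurableType d} {R : realType}.
Variables (P : probability Omega R) (I : choiceType) (Z : I -> {RV P >-> R}).
Implicit Types (S : set I) (E F : set Omega).

Definition cylinders S : set (set Omega) :=
  [set E | exists2 i, S i & exists2 B, measurable B & E = Z i @^-1` B].

Local Notation info S := (g_sigma_algebraType (cylinders S)).

Lemma info_measurable S E : <<s cylinders S >> E -> measurable E.
Proof.
move: E; apply: smallest_sub; first exact: sigma_algebra_measurable.
by move=> E [i _ [B mB ->]]; exact: measurable_funPTI.
Qed.

(** Measurability with respect to the sigma-algebra generated by the [Z i], [i] in
    [S].  This sigma-algebra lives on a copy of [Omega], so that closure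
    properties of measurable functions apply to adapted ones. *)
Definition adapted {d'} {Y : measurableType d'} S (f : Omega -> Y) :=
  @measurable_fun _ _ (info S) Y setT f.

Section adapted.
Context {d' : measure_display} {Y : measurableType d'}.

Lemma adapted_measurable S (f : Omega -> Y) : adapted S f -> measurable_fun setT f.
Proof. by move=> mf _ B mB; apply: (@info_measurable S); exact: mf. Qed.

End adapted.

Lemma adapted_Z S i : S i -> adapted S (Z i : Omega -> R).
Proof.
by move=> Si _ B mB; rewrite setTI; apply: sub_gen_smallest; exists i => //; exists B.
Qed.

(** The finite intersections of cylinders: a pi-system that generates the same
    sigma-algebra, and on which independence is the product formula. *)
Definition boxes S : set (set Omega) := [set E | exists (A : {fset I}) (B : I -> set R),
  [/\ forall i, i \in A -> S i, forall i, measurable (B i) &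
      E = \bigcap_(i in [set` A]) (Z i @^-1` B i)]].

Lemma boxes_cylinders S : cylinders S `<=` boxes S.
Proof.
move=> E [i Si [B mB ->]]; exists [fset i]%fset, (fun=> B); split => //.
- by move=> j /fset1P ->.
- by rewrite set_fset1 bigcap_set1.
Qed.

Lemma boxesI S : setI_closed (boxes S).
Proof.
move=> _ _ [A1 [B1 [sA1 mB1 ->]]] [A2 [B2 [sA2 mB2 ->]]].
exists (A1 `|` A2)%fset, (fun i => (if i \in A1 then B1 i else setT) `&`
  (if i \in A2 then B2 i else setT)); split.
- by move=> i /fsetUP[/sA1|/sA2].
- by move=> i; apply: measurableI; case: ifP.
- apply/seteqP; split => [x [h1 h2] i /= iA|x h].
    by split; case: ifP => // iA'; [exact: h1|exact: h2].
  split => i /= iA; have := h i; rewrite /= in_fsetU iA ?orbT => /(_ isT)[] //.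
Qed.

Hypothesis indepZ : mutually_independent Z.

Lemma boxes_indep S1 S2 E F : (forall i, S1 i -> S2 i -> False) ->
  boxes S1 E -> boxes S2 F -> P (E `&` F) = (P E * P F)%E.
Proof.
move=> S12 [A1 [B1 [sA1 mB1 ->]]] [A2 [B2 [sA2 mB2 ->]]].
have A12 i : i \in A1 -> i \in A2 -> False.
  move=> /sA1 S1i /sA2 S2i; exact: S12 S1i S2i.
pose B i := if i \in A1 then B1 i else B2 i.
have mB i : measurable (B i) by rewrite /B; case: ifP.
have -> : \bigcap_(i in [set` A1]) (Z i @^-1` B1 i) `&`
          \bigcap_(i in [set` A2]) (Z i @^-1` B2 i) =
          \bigcap_(i in [set` (A1 `|` A2)%fset]) (Z i @^-1` B i).
  apply/seteqP; split => [x [h1 h2] i /= iA|x h].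
    rewrite /B; case: ifPn => iA1; first exact: h1.
    by apply: h2 => /=; move: iA; rewrite in_fsetU (negbTE iA1).
  split => i /= iA; have := h i; rewrite /= in_fsetU iA ?orbT => /(_ isT).
    by rewrite /B iA.
  by rewrite /B; case: ifP => // /A12/(_ iA).
rewrite !indepZ//.
have -> : (\prod_(i <- (A1 `|` A2)%fset) P (Z i @^-1` B i))%E =
  (\prod_(i <- enum_fset A1 ++ enum_fset A2) P (Z i @^-1` B i))%E.
  apply: perm_big; apply: uniq_perm => //.
    rewrite cat_uniq !fset_uniq andbT /=; apply/hasPn => x xA2 /=.
    by apply/negP => /A12; exact.
  by move=> x; rewrite mem_cat in_fsetU.
rewrite big_cat/=; congr (_ * _)%E; apply: eq_big_seq => i iA; rewrite /B.
  by rewrite iA.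
by case: ifP => // /A12/(_ iA).
Qed.

Lemma indep_dynkin F : measurable F ->
  dynkin [set E | measurable E /\ P (E `&` F) = (P E * P F)%E].
Proof.
move=> mF; split.
- by split => //; rewrite setTI probability_setT mul1e.
- move=> E [mE EF]; split; first exact: measurableC.
  rewrite probability_setC// muleBl ?fin_num_measure//.
  rewrite mul1e -EF setIC -setDE measureD//; last by rewrite ltey_eq fin_num_measure.
  by rewrite setIC.
- move=> A tA hA; have mA n : measurable (A n) by case: (hA n).
  split; first exact: bigcup_measurable.
  rewrite setI_bigcupl measure_bigcup//; last first.
  + by apply: trivIset_setIr.
  + by move=> n _; exact: measurableI.
  rewrite measure_bigcup// muleC -(fineK (fin_num_measure P F mF)).
  rewrite -nneseriesZl//; apply: eq_eseriesr => n _; have [_] := hA n.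
  by rewrite muleC fineK ?fin_num_measure.
Qed.

(** The events independent of a given one form a Dynkin system, so independence
    extends from boxes to the generated sigma-algebras, one event at a time. *)
Lemma info_indep S1 S2 E F : (forall i, S1 i -> S2 i -> False) ->
  <<s cylinders S1 >> E -> <<s cylinders S2 >> F ->
  P (E `&` F) = (P E * P F)%E.
Proof.
have gen S (D : set (set Omega)) : dynkin D -> boxes S `<=` D ->
    <<s cylinders S >> `<=` D.
  move=> /dynkin_lambda_system lD bD; apply: (@subset_trans _ <<s boxes S >>).
    by apply: sub_sigma_algebra2; exact: boxes_cylinders.
  by apply: lambda_system_subset; [exact: boxesI|exact: lD|exact: bD|].
have mbox S G : boxes S G -> measurable G.
  move=> [A [B [_ mB ->]]]; apply: fin_bigcap_measurable; first exact: finite_fset.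
  by move=> i _; exact: measurable_funPTI.
move=> S12 sE sF; have mE := info_measurable sE.
suff : [set F | measurable F /\ P (F `&` E) = (P F * P E)%E] F.
  by move=> [_]; rewrite setIC muleC.
apply: (gen S2) sF; first exact: indep_dynkin.
move=> {F} F bF; split; first exact: mbox bF.
rewrite setIC muleC.
suff : [set E | measurable E /\ P (E `&` F) = (P E * P F)%E] E by case.
apply: (gen S1) sE; first by apply: indep_dynkin; exact: mbox bF.
move=> {mE} E bE; split; first exact: mbox bE.
exact: boxes_indep bE bF.
Qed.

(** The joint law of [f] and [g] is the product of their laws by [info_indep], and
    Tonelli's theorem applies. *)
Lemma expectation_indep S1 S2 (f g : Omega -> \bar R) :
  (forall i, S1 i -> S2 i -> False) -> adapted S1 f -> adapted S2 g ->
  (forall x, 0 <= f x)%E -> (forall x, 0 <= g x)%E ->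
  (\int[P]_x (f x * g x) = \int[P]_x f x * \int[P]_x g x)%E.
Proof.
move=> S12 mf mg f0 g0.
have mf' := adapted_measurable mf; have mg' := adapted_measurable mg.
have mfg : measurable_fun setT (fun x : Omega => (f x, g x)).
  exact: measurable_fun_pair.
pose X : {RV P >-> \bar R} := mfun_Sub (mem_set mf').
pose Y : {RV P >-> \bar R} := mfun_Sub (mem_set mg').
pose XY : {RV P >-> (\bar R * \bar R)%type} := mfun_Sub (mem_set mfg).
have mabs : measurable_fun setT (fun x : \bar R => `|x|%E) by exact: abse_measurable.
pose h (z : \bar R * \bar R) := (`|z.1| * `|z.2|)%E.
have mh : measurable_fun setT h.
  by apply: emeasurable_funM; apply: measurableT_comp.
have h0 z : (0 <= h z)%E by exact: mule_ge0.
transitivity (\int[distribution P XY]_z h z)%E.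
  rewrite ge0_integral_distribution//; apply: eq_integral => x _ /=.
  by rewrite /h /= !gee0_abs.
transitivity (\int[(distribution P X \x distribution P Y)%E]_z h z)%E.
  apply: eq_measure_integral => A mA _; apply/esym.
  apply: product_measure_unique => // B C mB mC.
  rewrite /distribution /pushforward /=.
  by apply: (info_indep S12); [rewrite -[X in _ X]setTI; exact: mf|
    rewrite -[X in _ X]setTI; exact: mg].
rewrite fubini_tonelli1// /fubini_F /h /=.
under eq_integral do rewrite ge0_integralZl//.
rewrite ge0_integralZr//; last exact: integral_ge0.
rewrite !ge0_integral_distribution//.
by congr (_ * _)%E; apply: eq_integral => x _ /=; rewrite gee0_abs.
Qed.

End independence.

(** * Laplace transform of the normal law *)

Section gaussian_mgf.
Context {R : realType}.

(** The Radon-Nikodym derivative of the normal law is almost everywhere equal to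
    [normal_pdf], since both have the same integrals. *)
Lemma ge0_integral_normal_prob (f : R -> \bar R) (m s : R) :
  measurable_fun setT f -> (forall x, 0 <= f x)%E ->
  (\int[normal_prob m s]_x f x =
   \int[lebesgue_measure]_x (f x * (normal_pdf m s x)%:E))%E.
Proof.
move=> mf f0; have dom := normal_prob_dominates m s.
rewrite -(Radon_Nikodym_SigmaFinite.change_of_variables dom f0)//.
have mpdf : measurable_fun setT (fun x => (normal_pdf m s x)%:E).
  by apply/measurable_EFinP; exact: measurable_normal_pdf.
have iRN := Radon_Nikodym_SigmaFinite.f_integrable dom.
apply: ae_eq_integral => //.
- by apply: emeasurable_funM => //; exact: measurable_int iRN.
- exact: emeasurable_funM.
- apply: ae_eqe_mul2l; apply: integral_ae_eq => //.
  by move=> E _ mE; rewrite -Radon_Nikodym_SigmaFinite.f_integral.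
Qed.

(** Completing the square turns the integrand into a constant multiple of the
    normal density of mean [l]. *)
Lemma normal_prob_mgf (l : R) :
  (\int[normal_prob 0 1]_x (expR (l * x))%:E = (expR (l ^+ 2 / 2))%:E)%E.
Proof.
rewrite ge0_integral_normal_prob; last 2 first.
- apply/measurable_EFinP; exact: measurableT_comp.
- by move=> x; rewrite lee_fin expR_ge0.
transitivity (\int[lebesgue_measure]_x
    ((expR (l ^+ 2 / 2))%:E * (normal_pdf l (1 : R) x)%:E))%E.
  apply: eq_integral => x _; rewrite -!EFinM; congr EFin.
  rewrite !normal_pdfE ?oner_neq0// /normal_fun mulrCA [RHS]mulrCA.
  congr (_ * _); rewrite -!expRD; congr expR.
  by rewrite subr0 expr1n; field.
rewrite ge0_integralZl//.
- by rewrite integral_normal_pdf mule1.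
- by apply/measurable_EFinP; exact: measurable_normal_pdf.
- by move=> x _; rewrite lee_fin normal_pdf_ge0.
Qed.

Context {d : measure_display} {Omega : measurableType d}.
Variables (P : probability Omega R).

Lemma gaussian_mgf (X : {RV P >-> R}) (l : R) : standard_gaussian X ->
  (\int[P]_w (expR (l * X w))%:E = (expR (l ^+ 2 / 2))%:E)%E.
Proof.
move=> gX; rewrite -normal_prob_mgf.
have me : measurable_fun setT (fun x : R => (expR (l * x))%:E).
  by apply/measurable_EFinP; exact: measurableT_comp.
transitivity (\int[distribution P X]_x (expR (l * x))%:E)%E.
  by rewrite ge0_integral_distribution.
(* The two sigma-algebras on the line agree but carry different displays, so
   the law is transported along the identity. *)
have mid : measurable_fun setT (idfun : measurableTypeR R -> R).
  by move=> _ B mB; rewrite setTI.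
rewrite -[RHS](ge0_integral_pushforward mid (normal_prob 0 1) measurableT me)//.
by apply: eq_measure_integral => A mA _; exact: gX.
Qed.

End gaussian_mgf.

(** * Partial sums along a branch *)

Section partial_sums.
Context {d : measure_display} {Omega : measurableType d} {R : realType}.
Variables (P : probability Omega R) (T : rooted_tree).
Variables (Z : T -> {RV P >-> R}) (alpha : nat -> R).
Implicit Types (u v : T) (S : set T).

Definition bsum (a b : nat) u (omega : Omega) : R :=
  \sum_(a <= k < b) alpha k * Z (anc k u) omega.

Definition var (a b : nat) : R := \sum_(a <= k < b) alpha k ^+ 2.

Lemma var_ge0 a b : 0 <= var a b.
Proof. by apply: sumr_ge0 => i _; exact: sqr_ge0. Qed.

Lemma var_cat a b c : (a <= b)%N -> (b <= c)%N -> var a c = var a b + var b c.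
Proof. by move=> ab bc; rewrite /var -big_cat_nat. Qed.

Lemma bsum_cat a b c u w : (a <= b)%N -> (b <= c)%N ->
  bsum a c u w = bsum a b u w + bsum b c u w.
Proof. by move=> ab bc; rewrite /bsum -big_cat_nat. Qed.

Lemma var_nil a b : (b <= a)%N -> var a b = 0.
Proof. by move=> ba; rewrite /var big_geq. Qed.

Lemma bsum_nil a b u w : (b <= a)%N -> bsum a b u w = 0.
Proof. by move=> ba; rewrite /bsum big_geq. Qed.

(** If the coefficients of a block vanish then so do its sums; this covers the
    degenerate blocks, where no normalization is possible. *)
Lemma bsum_var0 a b c u w : var a c = 0 -> (b <= c)%N -> bsum a b u w = 0.
Proof.
rewrite /var big_nat => /eqP; rewrite psumr_eq0; last by move=> i _; exact: sqr_ge0.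
move=> /allP a0 bc; rewrite /bsum big_nat big1// => k /andP[ak kb].
have kc := leq_trans kb bc.
have := a0 k; rewrite mem_index_iota ak kc sqrf_eq0 => /(_ isT)/eqP ->.
by rewrite mul0r.
Qed.

Lemma eq_bsum a b u v w : (forall k, (a <= k < b)%N -> anc k u = anc k v) ->
  bsum a b u w = bsum a b v w.
Proof. by move=> uv; apply: eq_big_nat => k kab; rewrite uv. Qed.

Lemma adapted_bsum S a b u : (forall k, (a <= k < b)%N -> S (anc k u)) ->
  adapted Z S (bsum a b u).
Proof.
move=> hS; rewrite /adapted /bsum.
rewrite (_ : (fun w => _) = (fun w : g_sigma_algebraType (cylinders Z S) =>
    \sum_(k <- index_iota a b) if (a <= k < b)%N then alpha k * Z (anc k u) w else 0)).
  apply: measurable_sum => k; have [kab|kab] := boolP (a <= k < b)%N;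
    last exact: measurable_cst.
  by apply: measurable_funM; [exact: measurable_cst|apply: adapted_Z; exact: hS].
by apply/funext => w; apply: eq_big_nat => k ->.
Qed.

Lemma adapted_expR S l a b u : (forall k, (a <= k < b)%N -> S (anc k u)) ->
  adapted Z S (fun w => (expR (l * bsum a b u w))%:E).
Proof.
move=> hS; apply/measurable_EFinP; apply: measurableT_comp => //.
by apply: measurable_funM; [exact: measurable_cst|exact: adapted_bsum].
Qed.

Lemma measurable_bsum a b u : measurable_fun setT (bsum a b u).
Proof. by apply: (@adapted_measurable _ _ _ _ _ Z _ _ setT); exact: adapted_bsum. Qed.

Hypothesis gZ : forall v, standard_gaussian (Z v).
Hypothesis indepZ : mutually_independent Z.

(** The vertices of one branch are distinct, so the summands are independent.  All
    later estimates use the Gaussian law through this formula alone. *)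
Lemma bsum_mgf l a b u : (b <= (level u).+1)%N ->
  (\int[P]_w (expR (l * bsum a b u w))%:E = (expR (l ^+ 2 / 2 * var a b))%:E)%E.
Proof.
have triv c : (c <= a)%N ->
    (\int[P]_w (expR (l * bsum a c u w))%:E = (expR (l ^+ 2 / 2 * var a c))%:E)%E.
  move=> ca; rewrite /var big_geq// mulr0 expR0.
  under eq_integral do rewrite /bsum big_geq// mulr0 expR0.
  by rewrite -[RHS](@probability_setT _ _ _ P) integral_cst// mul1e.
elim: b => [|b IH] bu; first exact: triv.
have [ab|ab] := leqP a b; last exact: triv.
rewrite /var big_nat_recr//= -/(var a b) mulrDr expRD EFinM -IH; last exact: ltnW.
have -> : l ^+ 2 / 2 * alpha b ^+ 2 = (l * alpha b) ^+ 2 / 2 by ring.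
rewrite -(gaussian_mgf (l * alpha b) (gZ (anc b u))).
rewrite -(@expectation_indep _ _ _ _ _ Z indepZ
  [set x | exists2 k, (a <= k < b)%N & x = anc k u] [set anc b u]).
- apply: eq_integral => w _; rewrite -EFinM -expRD; congr (expR _)%:E.
  by rewrite /bsum big_nat_recr//= mulrDr mulrA.
- move=> _ [k /andP[_ kb] ->] /= /(anc_inj _ _) kE.
  by have kE' := kE (leq_trans (ltnW kb) bu) bu; rewrite kE' ltnn in kb.
- by apply: adapted_expR => k kab; exists k.
- apply/measurable_EFinP; apply: measurableT_comp => //.
  by apply: measurable_funM; [exact: measurable_cst|exact: adapted_Z].
- by move=> w; rewrite lee_fin expR_ge0.
- by move=> w; rewrite lee_fin expR_ge0.
Qed.

End partial_sums.

(** * Lower tail bound by exponential tilting *)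

Section tilting.
Context {d : measure_display} {Omega : measurableType d} {R : realType}.
Variables (P : probability Omega R).

Definition tail_cst : R := expR (- 10) / 3.

Lemma tail_cst_gt0 : 0 < tail_cst.
Proof. by rewrite divr_gt0// expR_gt0. Qed.

Lemma expRN2_le : 2 * expR (- 2) <= 2 / 3 :> R.
Proof.
rewrite ler_pM2l// expRN lef_pV2 ?posrE ?expR_gt0//.
by apply: le_trans (expR_ge1Dx 2); lra.
Qed.

(** Exponential tilting.  Let [s ^ 2 = v] and [l = (t + 2) / s].  Under the
    density proportional to [expR (l * X)] the variable has mean [l * v] and
    deviation [s]; the two terms with [K2] and [K3] show that the part outside the
    window [l * v - 2 * s <= X <= l * v + 2 * s] takes at most
    [2 * expR (- 2) <= 2 / 3] of the total.  At least one third of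
    [expR (l ^+ 2 / 2 * v)] comes from the window, where [X >= t * s] and
    [expR (l * X)] is at most [K1]. *)
Lemma gaussian_tail (X : Omega -> R) (v t : R) : measurable_fun setT X ->
  (forall l, \int[P]_w (expR (l * X w))%:E = (expR (l ^+ 2 / 2 * v))%:E)%E ->
  0 < v -> 0 <= t ->
  ((tail_cst * expR (- (2 * t ^+ 2)))%:E <= P [set w | (t * Num.sqrt v <= X w)%R])%E.
Proof.
move=> mX mgfX v0 t0; set s := Num.sqrt v.
have s0 : 0 < s by rewrite sqrtr_gt0.
have s2 : s ^+ 2 = v by rewrite sqr_sqrtr// ltW.
set A := [set w | _]; have mA : measurable A.
  rewrite (_ : A = X @^-1` `[t * s, +oo[); last first.
    by apply/seteqP; split => w /=; rewrite in_itv/= andbT.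
  by rewrite -[X in measurable X]setTI; exact: mX.
pose l := (t + 2) / s; pose u := 2 / s.
pose K1 := expR (l * (l * v + 2 * s)).
pose K2 := expR (u * (l * v - 2 * s)).
pose K3 := expR (- (u * (l * v + 2 * s))).
have ls : l * v - 2 * s = t * s.
  by rewrite /l -s2; field; exact: lt0r_neq0.
have pw w : expR (l * X w) <= K1 * \1_A w + K2 * expR ((l - u) * X w) +
    K3 * expR ((l + u) * X w).
  have u0 : 0 <= u by rewrite divr_ge0// ltW.
  have l0 : 0 <= l by rewrite divr_ge0 ?addr_ge0// ltW.
  have e2 : 0 <= K2 * expR ((l - u) * X w) by rewrite mulr_ge0 ?expR_ge0.
  have e3 : 0 <= K3 * expR ((l + u) * X w) by rewrite mulr_ge0 ?expR_ge0.
  have [XA|XA] := lerP (t * s) (X w); last first.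
    have : expR (l * X w) <= K2 * expR ((l - u) * X w).
      rewrite /K2 -expRD ler_expR.
      by rewrite -subr_ge0 (_ : _ - _ = u * (t * s - X w));
        [rewrite mulr_ge0// subr_ge0 ltW|rewrite ls; ring].
    have := mulr_ge0 (expR_ge0 (l * (l * v + 2 * s))) (ler0n R (w \in A));
      rewrite -/K1 indicE; lra.
  have iA : \1_A w = 1 :> R by rewrite indicE mem_set.
  rewrite iA mulr1; have [XB|XB] := lerP (X w) (l * v + 2 * s).
    have : expR (l * X w) <= K1 by rewrite ler_expR ler_wpM2l.
    lra.
  have : expR (l * X w) <= K3 * expR ((l + u) * X w).
    rewrite /K3 -expRD ler_expR.
    by rewrite -subr_ge0 (_ : _ - _ = u * (X w - (l * v + 2 * s)));
      [rewrite mulr_ge0// subr_ge0 ltW|ring].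
  have := expR_ge0 (l * (l * v + 2 * s)); rewrite -/K1; lra.
have mexp k : measurable_fun setT (fun w => (expR (k * X w))%:E).
  apply/measurable_EFinP; apply: measurableT_comp => //; exact: measurable_funM.
have : ((expR (l ^+ 2 / 2 * v))%:E <= K1%:E * P A +
    K2%:E * (expR ((l - u) ^+ 2 / 2 * v))%:E +
    K3%:E * (expR ((l + u) ^+ 2 / 2 * v))%:E)%E.
  rewrite -mgfX -(mgfX (l - u)) -(mgfX (l + u)).
  rewrite -[X in (K1%:E * P X)%E]setIT -integral_indic//.
  rewrite -!ge0_integralZl//; try (by rewrite lee_fin expR_ge0);
    try (by move=> w _; rewrite lee_fin ?expR_ge0).
  rewrite -!ge0_integralD//; first last.
  all: try (by move=> w _; rewrite ?adde_ge0 ?mule_ge0 ?lee_fin ?expR_ge0).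
  all: try by do ?[apply: emeasurable_funD|apply: emeasurable_funM] => //;
    apply/measurable_EFinP.
  apply: ge0_le_integral => //.
  - by do ?[apply: emeasurable_funD|apply: emeasurable_funM] => //; apply/measurable_EFinP.
  - by move=> w _; rewrite -!EFinM -!EFinD lee_fin; exact: pw.
rewrite -(fineK (fin_num_measure P A mA)) -!EFinM -!EFinD !lee_fin.
set p := fine (P A).
set e := expR (l ^+ 2 / 2 * v).
have -> : K2 * expR ((l - u) ^+ 2 / 2 * v) = e * expR (- 2).
  rewrite /K2 /e -!expRD; congr expR; rewrite /u -s2; field; exact: lt0r_neq0.
have -> : K3 * expR ((l + u) ^+ 2 / 2 * v) = e * expR (- 2).
  rewrite /K3 /e -!expRD; congr expR; rewrite /u -s2; field; exact: lt0r_neq0.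
have e0 : 0 < e by exact: expR_gt0.
move=> H; have K1p : e / 3 <= K1 * p.
  have := expRN2_le; rewrite -(ler_pM2l e0); lra.
have lsE : l * s = t + 2 by rewrite /l; field; exact: lt0r_neq0.
have K1e : K1 <= e * expR (10 + 2 * t ^+ 2).
  rewrite /K1 /e -expRD ler_expR -s2.
  have -> : l * (l * s ^+ 2 + 2 * s) = (t + 2) ^+ 2 + 2 * (t + 2) by rewrite -lsE; ring.
  have -> : l ^+ 2 / 2 * s ^+ 2 = (t + 2) ^+ 2 / 2 by rewrite -lsE; ring.
  by have := sqr_ge0 (t - 4 / 3); nra.
have p0 : 0 <= p by exact: fine_ge0.
have : e * (1 / 3) <= e * (expR (10 + 2 * t ^+ 2) * p).
  apply: le_trans (_ : K1 * p <= _); first by rewrite div1r.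
  by rewrite mulrA ler_wpM2r.
rewrite ler_pM2l// => H3.
rewrite /tail_cst mulrAC -expRD ler_pdivrMr//.
rewrite -[leLHS]mulr1 -ler_pdivlMl ?expR_gt0// -expRN opprD !opprK; lra.
Qed.

End tilting.

(** * Minimum over a finite list *)

Section list_min.
Context {R : realType} {T : eqType}.
Local Open Scope ereal_scope.

Fixpoint minl (f : T -> \bar R) (us : seq T) : \bar R :=
  if us is u :: us' then mine (f u) (minl f us') else +oo.

Lemma le_minl x f us : (forall u, u \in us -> x <= f u) -> x <= minl f us.
Proof.
elim: us => [|u us IH] h /=; first exact: leey.
rewrite le_min h ?mem_head//= IH// => v vus; apply: h.
by rewrite inE vus orbT.
Qed.

Lemma minl_le f us u : u \in us -> minl f us <= f u.
Proof.
elim: us => [//|v us IH]; rewrite inE => /orP[/eqP ->|uus] /=.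
  by rewrite ge_min lexx.
by rewrite ge_min IH// orbT.
Qed.

Lemma minlZ_ge x (c : R) f us : (0 < c)%R ->
  (forall u, u \in us -> x <= c%:E * f u) -> x <= c%:E * minl f us.
Proof.
move=> c0; elim: us => [|u us IH] h /=; first by rewrite gt0_muley// leey.
rewrite /mine; case: ifP => _; first by apply: h; rewrite mem_head.
by apply: IH => v vus; apply: h; rewrite inE vus orbT.
Qed.

End list_min.

(** * The greedy search across one block *)

Section greedy.
Context {d : measure_display} {Omega : measurableType d} {R : realType}.
Variables (P : probability Omega R) (T : rooted_tree).
Variables (Z : T -> {RV P >-> R}) (alpha : nat -> R).
Hypothesis lf : locally_finite T.
Hypothesis ll : leafless T.
Hypothesis gZ : forall v, standard_gaussian (Z v).
Hypothesis indepZ : mutually_independent Z.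
Implicit Types (u v : T) (S : set T).

Local Notation desc_level := (desc_level lf).
Local Notation desc_anc := (desc_anc lf).
Local Notation desc_anc_start := (desc_anc_start lf).
Local Notation desc_trans := (desc_trans lf).
Local Notation desc_heir := (desc_heir lf ll).
Local Notation heir := (heir ll).
Local Notation bsum := (bsum Z alpha).
Local Notation var := (var alpha).

Lemma adapted_minl S (f : T -> Omega -> \bar R) us :
  (forall u, u \in us -> adapted Z S (f u)) ->
  adapted Z S (fun w => minl (f^~ w) us).
Proof.
elim: us => [|u us IH] h /=; first exact: measurable_cst.
apply: measurable_mine; first by apply: h; rewrite mem_head.
by apply: IH => v vus; apply: h; rewrite inE vus orbT.
Qed.

Variable theta : R.

(** For [theta >= 0], [expR (- theta * M)] with [M] the largest increment from
    [v] to a descendant [n] levels below. *)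
Definition Emin v n (w : Omega) : \bar R :=
  minl (fun u => (expR (- theta * bsum (level v).+1 (level v + n).+1 u w))%:E)
    (desc v n).

Lemma Emin_ge0 v n w : (0 <= Emin v n w)%E.
Proof. by apply: le_minl => u _; rewrite lee_fin expR_ge0. Qed.

(** The subtree below [u].  Cones of distinct vertices of the same level are
    disjoint, which makes the search along them independent. *)
Definition cone u : set T := [set x | (level u <= level x)%N /\ anc (level u) x = u].

Lemma cone_desc u n x k : x \in desc u n ->
  (level u <= k)%N -> (k <= level u + n)%N -> cone u (anc k x).
Proof.
move=> xu uk kn; have lx := desc_level xu.
have kx : (k <= level x)%N by rewrite lx.
by split; rewrite ?level_anc// anc_anc// (desc_anc_start xu).
Qed.

Lemma adapted_Emin S v n :
  (forall x, (level v < level x)%N -> cone v x -> S x) -> adapted Z S (Emin v n).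
Proof.
move=> hS; apply: adapted_minl => u ud; apply: adapted_expR => k /andP[vk kn].
apply: hS; last by apply: (cone_desc ud) => //; exact: ltnW.
by rewrite level_anc// (desc_level ud).
Qed.

Lemma Emin_expectation v n :
  (\int[P]_w Emin v n w <=
   (expR (theta ^+ 2 / 2 * var (level v).+1 (level v + n).+1))%:E)%E.
Proof.
have hd := desc_heir v n.
rewrite -sqrrN -(bsum_mgf alpha gZ indepZ (- theta) (level v).+1 (u := iter n heir v)).
  apply: ge0_le_integral => //.
  - by move=> w _; exact: Emin_ge0.
  - by apply: (@adapted_measurable _ _ _ _ _ Z _ _ setT); exact: adapted_Emin.
  - by apply: (@adapted_measurable _ _ _ _ _ Z _ _ setT); exact: adapted_expR.
  - by move=> w _; exact: minl_le.
by rewrite (desc_level hd).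
Qed.

Section block.
Variables (v : T) (m e n : nat).
(* The levels of the candidates and of the ends of their arms. *)
Local Notation L1 := (level v + m)%N.
Local Notation L2 := (level v + m + e)%N.

(** The end of the arm attached to the candidate [u]; any rule that chooses one
    descendant serves. *)
Definition follow u := iter e heir u.

(** The share of the candidate [u] in [Emin]: the path from [v] to [u], the arm
    across the block, and the best continuation from its end. *)
Definition candidate u (w : Omega) : \bar R :=
  ((expR (- theta * bsum (level v).+1 L1 u w))%:E *
   ((expR (- theta * bsum L1 L2.+1 (follow u) w))%:E * Emin (follow u) n w))%E.

Lemma candidate_ge0 u w : (0 <= candidate u w)%E.
Proof. by rewrite /candidate !mule_ge0 ?Emin_ge0 ?lee_fin ?expR_ge0. Qed.

Lemma follow_desc u : follow u \in desc u e.
Proof. exact: desc_heir. Qed.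

Hypothesis m_gt0 : (0 < m)%N.

Lemma Emin_le_candidates w :
  (Emin v (m + e + n) w <= minl (candidate^~ w) (desc v m))%E.
Proof.
apply: le_minl => u uv; rewrite /candidate muleA -EFinM -expRD.
apply: minlZ_ge; first exact: expR_gt0.
move=> x xd; have fd := follow_desc u.
have xv : x \in desc v (m + e + n).
  by apply: desc_trans xd; exact: desc_trans fd.
apply: le_trans (minl_le _ xv) _.
have lu : level u = L1 by exact: desc_level uv.
have lfu : level (follow u) = L2 by rewrite (desc_level fd) lu.
rewrite -EFinM -expRD -!mulrDr lee_fin ler_expR lfu.
rewrite (bsum_cat _ _ _ _ (b := L1)); [|lia|lia].
rewrite (bsum_cat _ _ _ _ (a := L1) (b := L2.+1)); [|lia|lia].
rewrite addrA !addnA [bsum _ _ x w](@eq_bsum _ _ _ _ _ _ _ _ _ x u); last first.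
  move=> k /andP[_ k1]; rewrite (desc_anc xd) ?(desc_anc fd)//; lia.
rewrite [bsum L1 _ x w](@eq_bsum _ _ _ _ _ _ _ _ _ x (follow u))//.
by move=> k /andP[_ k1]; rewrite (desc_anc xd)//; lia.
Qed.

Variables (phi t q : R).
Hypothesis phiP : forall u, level u = L2 -> (\int[P]_w Emin u n w <= phi%:E)%E.
Hypothesis theta_ge0 : 0 <= theta.
Hypothesis t_ge0 : 0 <= t.
Hypothesis q_ge0 : 0 <= q.
Hypothesis qP : forall u, level u = L2 ->
  (q%:E <= P [set w | (t <= bsum L1 L2.+1 u w)%R])%E.

Let phi_ge0 : 0 <= phi.
Proof.
pose u := iter (m + e) heir v.
have lu : level u = L2 by rewrite (desc_level (desc_heir v (m + e))) addnA.
rewrite -lee_fin; apply: le_trans (phiP lu).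
by apply: integral_ge0 => w _; exact: Emin_ge0.
Qed.

Let Phi := expR (theta ^+ 2 / 2 * var (level v).+1 L1) * phi.

Let kappa := expR (theta ^+ 2 / 2 * var L1 L2.+1).

Let noise u w := (expR (- theta * bsum (level v).+1 L1 u w))%:E.

Let noise_expectation u : u \in desc v m ->
  (\int[P]_w (noise u w * Emin (follow u) n w) <= Phi%:E)%E.
Proof.
move=> uv; have lu : level u = L1 by exact: desc_level uv.
have lfu : level (follow u) = L2 by rewrite (desc_level (follow_desc u)) lu.
rewrite (@expectation_indep _ _ _ _ _ Z indepZ
  [set x | (level x < L1)%N] [set x | (L2 < level x)%N]).
- rewrite /noise bsum_mgf// ?sqrrN; last by rewrite lu.
  rewrite /Phi EFinM lee_wpmul2l ?lee_fin ?expR_ge0//; exact: phiP.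
- by move=> x /=; lia.
- apply: adapted_expR => k /andP[k1 k2] /=; rewrite level_anc//; lia.
- apply: adapted_Emin => x /=; rewrite lfu; lia.
- by move=> w; rewrite lee_fin expR_ge0.
- by move=> w; exact: Emin_ge0.
Qed.

Let cone_follow u k : u \in desc v m -> (L1 <= k)%N -> (k <= L2)%N ->
  cone u (anc k (follow u)).
Proof.
move=> uv k1 k2; have lu := desc_level uv.
by apply: (cone_desc (follow_desc u)); rewrite lu.
Qed.

Let cone_Emin u x : u \in desc v m -> (level (follow u) < level x)%N ->
  cone (follow u) x -> cone u x.
Proof.
move=> uv + [xf xe]; have lu := desc_level uv.
rewrite (desc_level (follow_desc u)) => xl; split; first lia.
rewrite -{2}(desc_anc_start (follow_desc u)) -xe anc_anc//.
by rewrite (desc_level (follow_desc u)) leq_addr.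
Qed.

Let adapted_candidate u u' : u \in desc v m -> u' \in desc v m -> u != u' ->
  adapted Z (~` cone u) (candidate u').
Proof.
move=> uv u'v uu'; have lu := desc_level uv; have lu' := desc_level u'v.
have dis x : cone u' x -> (~` cone u) x.
  by move=> [_ xu'] [_ xu]; move: uu'; rewrite -xu -xu' lu lu' eqxx.
apply: emeasurable_funM; last apply: emeasurable_funM.
- apply: adapted_expR => k /andP[_ k2] [] /=; rewrite level_anc; lia.
- by apply: adapted_expR => k /andP[k1 k2]; apply/dis/cone_follow.
- by apply: adapted_Emin => x xl xc; apply/dis/cone_Emin.
Qed.

Let inside : set T := [set x | (L1 <= level x <= L2)%N].
Let outside : set T := [set x | (level x < L1)%N \/ (L2 < level x)%N].

Let inside_outside x : inside x -> outside x -> False.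
Proof. by rewrite /inside /outside /=; lia. Qed.

Let arm_inside u k : u \in desc v m -> (L1 <= k < L2.+1)%N ->
  inside (anc k (follow u)).
Proof.
move=> uv /andP[k1 k2]; rewrite /inside /= level_anc ?k1//.
by rewrite (desc_level (follow_desc u)) (desc_level uv).
Qed.

Let adapted_rest u : u \in desc v m ->
  adapted Z outside (fun w => (noise u w * Emin (follow u) n w)%E).
Proof.
move=> uv; have lu : level u = L1 by exact: desc_level uv.
have lfu : level (follow u) = L2 by rewrite (desc_level (follow_desc u)) lu.
apply: emeasurable_funM.
  by apply: adapted_expR => k /andP[k1 k2] /=; left; rewrite level_anc//; lia.
by apply: adapted_Emin => x xl _ /=; right; rewrite -lfu.
Qed.

(** The greedy choice, by induction on the list of candidates.  If the arm of the
    first candidate exceeds [t], follow it and gain [expR (- (theta * t))];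
    otherwise turn to the remaining candidates, which are independent of that arm.
    The arm itself is independent of the levels before and after it.  Only the last
    candidate is taken without looking at its arm, and costs the Laplace transform
    [kappa] of an arm. *)
Lemma candidates_expectation us : us != [::] -> uniq us ->
  {subset us <= desc v m} ->
  (\int[P]_w minl (candidate^~ w) us <=
   (Phi * kappa * (expR (- (theta * t)) +
     (1 - q) ^+ (size us).-1 * (1 - expR (- (theta * t)))))%:E)%E.
Proof.
have kappa1 : 1 <= kappa.
  by rewrite -[leLHS]expR0 ler_expR mulr_ge0 ?var_ge0// divr_ge0// sqr_ge0.
have Phi0 : 0 <= Phi by rewrite mulr_ge0// expR_ge0.
have mc u : measurable_fun setT (candidate u).
  apply: (@adapted_measurable _ _ _ _ _ Z _ _ setT).
  by apply: emeasurable_funM; [|apply: emeasurable_funM];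
    rewrite -/(adapted Z setT _); [exact: adapted_expR|exact: adapted_expR|exact: adapted_Emin].
elim: us => [//|u us IH] _ /= /andP[uus usU] sub.
have uv : u \in desc v m by apply: sub; rewrite mem_head.
have subus : {subset us <= desc v m} by move=> x xus; apply: sub; rewrite inE xus orbT.
have lu : level u = L1 by exact: desc_level uv.
have lfu : level (follow u) = L2 by rewrite (desc_level (follow_desc u)) lu.
have [us0|usN] := eqVneq us [::].
  rewrite us0 /= expr0 mul1r addrC subrK mulr1.
  under eq_integral do rewrite (min_l (leey _)) /candidate muleCA.
  rewrite (@expectation_indep _ _ _ _ _ Z indepZ
    inside outside _ _ inside_outside).
  - rewrite bsum_mgf// ?sqrrN ?lfu// -/kappa mulrC EFinM lee_wpmul2l ?lee_fin ?expR_ge0//.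
    exact: noise_expectation.
  - by apply: adapted_expR => k; exact: arm_inside.
  - exact: adapted_rest.
  - by move=> w; rewrite lee_fin expR_ge0.
  - by move=> w; rewrite mule_ge0 ?Emin_ge0 ?lee_fin ?expR_ge0.
have {IH}IH := IH usN usU subus.
set A := bsum L1 L2.+1 (follow u).
have mA : measurable_fun setT A by exact: measurable_bsum.
pose E := [set w | (t <= A w)%R].
have EE : E = A @^-1` `[t, +oo[.
  by apply/seteqP; split => w /=; rewrite in_itv/= andbT.
have mE : measurable E by rewrite EE -[X in measurable X]setTI; exact: mA.
have aE S : (forall k, (L1 <= k < L2.+1)%N -> S (anc k (follow u))) ->
    adapted Z S (fun w => (\1_E w)%:E : \bar R).
  move=> hS; apply/measurable_EFinP; apply: measurable_indic.
  rewrite EE -[X in measurable X]setTI.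
  by apply: (@adapted_bsum _ _ _ _ _ Z alpha _ _ _ _ hS) => //.
have aEC S : (forall k, (L1 <= k < L2.+1)%N -> S (anc k (follow u))) ->
    adapted Z S (fun w => (\1_(~` E) w)%:E : \bar R).
  move=> hS; apply/measurable_EFinP; apply: measurable_indic.
  apply: measurableC; rewrite EE -[X in measurable X]setTI.
  by apply: (@adapted_bsum _ _ _ _ _ Z alpha _ _ _ _ hS) => //.
set X := Phi * kappa * (expR (- (theta * t)) +
     (1 - q) ^+ (size us).-1 * (1 - expR (- (theta * t)))) in IH *.
set p := fine (P E).
have pE : P E = p%:E by rewrite fineK// fin_num_measure.
have pq : q <= p by rewrite -lee_fin -pE; exact: qP.
have p1 : p <= 1 by rewrite -lee_fin -pE; exact: probability_le1.
have et1 : expR (- (theta * t)) <= 1.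
  by rewrite -[leRHS]expR0 ler_expR oppr_le0 mulr_ge0.
have q1 : q <= 1 by exact: le_trans p1.
set et := expR (- (theta * t)) in X IH et1 *.
have et0 : 0 <= et by exact: expR_ge0.
have pi0 k : 0 <= (1 - q) ^+ k by rewrite exprn_ge0// subr_ge0.
have XPhi : et * Phi <= X.
  rewrite /X mulrC -mulrA ler_wpM2l//.
  apply: le_trans (_ : kappa * et <= _); first by rewrite ler_peMl.
  by rewrite ler_wpM2l ?expR_ge0// lerDl mulr_ge0// subr_ge0.
have cand0 w : (0 <= minl (candidate^~ w) us)%E.
  by apply: le_minl => x _; exact: candidate_ge0.
have mcand : measurable_fun setT (fun w => minl (candidate^~ w) us).
  apply: (@adapted_measurable _ _ _ _ _ Z _ _ (~` cone u)).
  apply: adapted_minl => x xus; apply: adapted_candidate => //; first exact: subus.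
  by apply: contraNneq uus => ->.
(* On [E] the arm of [u] is followed, off [E] the search turns to [us]. *)
pose F1 w := ((\1_E w)%:E * (et%:E * (noise u w * Emin (follow u) n w)))%E.
pose F2 w := ((\1_(~` E) w)%:E * minl (candidate^~ w) us)%E.
have mnE := adapted_rest uv.
have nE0 w : (0 <= noise u w * Emin (follow u) n w)%E.
  by rewrite mule_ge0 ?Emin_ge0 ?lee_fin ?expR_ge0.
have mE1 : measurable_fun setT (fun w => (\1_E w)%:E : \bar R).
  by apply/measurable_EFinP.
have mE2 : measurable_fun setT (fun w => (\1_(~` E) w)%:E : \bar R).
  by apply/measurable_EFinP; apply: measurable_indic; exact: measurableC.
have mF1 : measurable_fun setT F1.
  apply: emeasurable_funM => //; apply: emeasurable_funM => //.
  exact: adapted_measurable mnE.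
have mF2 : measurable_fun setT F2 by apply: emeasurable_funM.
have F10 w : (0 <= F1 w)%E.
  by rewrite !mule_ge0// ?lee_fin// ?expR_ge0// Emin_ge0.
have F20 w : (0 <= F2 w)%E by rewrite mule_ge0// lee_fin.
apply: le_trans (_ : \int[P]_w (F1 w + F2 w) <= _)%E.
  apply: ge0_le_integral => //.
  - by move=> w _; rewrite le_min candidate_ge0 cand0.
  - exact: measurable_mine.
  - exact: emeasurable_funD.
  - move=> w _; rewrite /F1 /F2 !indicE in_setC; case: (boolP (w \in E)) => wE.
      rewrite /= mul0e adde0 mul1e; apply: le_trans (_ : candidate u w <= _)%E.
        by rewrite ge_min lexx.
      rewrite /candidate muleCA; apply: lee_wpmul2r; first exact: nE0.
      rewrite lee_fin ler_expR mulNr lerN2 ler_wpM2l//.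
      by move: wE; rewrite inE.
    by rewrite /= mul0e add0e mul1e ge_min lexx orbT.
rewrite ge0_integralD//.
have -> : (\int[P]_w F1 w = p%:E * (et%:E * \int[P]_w (noise u w * Emin (follow u) n w)))%E.
  rewrite -ge0_integralZl//; last exact: adapted_measurable mnE.
  rewrite -pE -[E in P E]setIT -integral_indic//.
  apply: (@expectation_indep _ _ _ _ _ Z indepZ
    inside outside _ _ inside_outside) => //.
  - by apply: aE => k; exact: arm_inside.
  - by apply: emeasurable_funM => //; exact: measurable_cst.
  - by move=> w; rewrite mule_ge0// lee_fin.
have -> : (\int[P]_w F2 w = (1 - p)%:E * \int[P]_w minl (candidate^~ w) us)%E.
  have -> : ((1 - p)%:E = P (~` E))%E by rewrite probability_setC// pE.
  rewrite -[X in P X]setIT -integral_indic//; last exact: measurableC.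
  apply: (@expectation_indep _ _ _ _ _ Z indepZ (cone u) (~` cone u)) => //.
  - apply: aEC => k /andP[k1 k2]; exact: cone_follow.
  - apply: adapted_minl => x xus; apply: adapted_candidate => //; first exact: subus.
    by apply: contraNneq uus => ->.
apply: le_trans (_ : p%:E * (et%:E * Phi%:E) + (1 - p)%:E * X%:E <= _)%E.
  apply: leeD; rewrite lee_wpmul2l ?lee_fin ?subr_ge0//; first exact: le_trans pq.
  by rewrite lee_wpmul2l ?lee_fin//; exact: noise_expectation.
rewrite -!EFinM -!EFinD lee_fin.
apply: le_trans (_ : q * (et * Phi) + (1 - q) * X <= _).
  by rewrite -subr_ge0 (_ : _ - _ = (p - q) * (X - et * Phi));
    [rewrite mulr_ge0// subr_ge0|ring].
have -> : size us = (size us).-1.+1 by case: (us) usN.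
rewrite /= exprS; apply: le_trans (_ : q * (et * (Phi * kappa)) + (1 - q) * X <= _).
  rewrite lerD2r ler_wpM2l// ler_wpM2l// ler_peMr//.
by rewrite /X -subr_ge0 (_ : _ - _ = 0)//; ring.
Qed.

End block.
End greedy.

(** * The small ball estimate *)

Section greedy_recursion.
Context {R : realType}.

(** Half of a lower bound for the probability that some arm succeeds; the other
    half is lost in the linearization [expRN_le]. *)
Definition greedy_cst : R := (1 - expR (- ((@tail_cst R) / 2))) / 2.

Lemma greedy_cst_gt0 : 0 < greedy_cst.
Proof.
rewrite divr_gt0// subr_gt0 -[ltRHS]expR0 ltr_expR oppr_lt0 divr_gt0//.
exact: tail_cst_gt0.
Qed.

Lemma greedy_cst_le1 : greedy_cst <= 1.
Proof. by rewrite /greedy_cst; have := expR_ge0 (- ((@tail_cst R) / 2)); lra. Qed.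

Lemma tail_cst_le1 : (@tail_cst R) <= 1.
Proof.
have : expR (- 10) <= 1 :> R by rewrite -[leRHS]expR0 ler_expR; lra.
by rewrite /tail_cst; lra.
Qed.

Lemma expRN_le (x : R) : 0 <= x -> x <= 1 -> expR (- x) <= 1 - x / 2.
Proof.
move=> x0 x1; have p0 : 0 < 1 - x / 2 by lra.
rewrite expRN -[leRHS]invrK lef_pV2 ?posrE ?expR_gt0 ?invr_gt0//.
by apply: le_trans (expR_ge1Dx x); rewrite -[leLHS]mul1r ler_pdivrMr//; nra.
Qed.

Lemma ln2_ge : 1 / 2 <= ln 2 :> R.
Proof.
rewrite -ler_expR lnK ?posrE//.
have := expR_ge1Dx (- (1 / 2) : R); rewrite expRN => h.
rewrite -[leRHS]invrK -[leLHS]invrK lef_pV2 ?posrE ?invr_gt0 ?expR_gt0//; lra.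
Qed.

(* The probability that at least one of N-1 independent candidates succeeds. *)
(** One candidate is lost since the last one is followed whatever its arm does;
    for at least two candidates this halves the exponent at worst. *)
Lemma success_ge (q : R) (N : nat) : (1 < N)%N -> 0 <= q -> q <= 1 ->
  (@tail_cst R) <= q * N%:R -> (1 - q) ^+ N.-1 <= expR (- ((@tail_cst R) / 2)).
Proof.
move=> N1 q0 q1 qN.
apply: (@le_trans _ _ (expR (- q) ^+ N.-1)).
  by apply: lerXn2r; rewrite ?nnegrE ?subr_ge0 ?expR_ge0//; exact: expR_ge1Dx.
rewrite -expRM_natl ler_expR.
have : N%:R <= 2 * N.-1%:R :> R by rewrite -natrM ler_nat; lia.
move=> /(ler_wpM2l q0); nra.
Qed.

Lemma parity_sum (t : nat -> R) J :
  \sum_(i < J) t i = \sum_(i < uphalf J) t (0 + i.*2)%N + \sum_(i < J./2) t (1 + i.*2)%N.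
Proof.
elim: J => [|J IH]; first by rewrite !big_ord0 addr0.
rewrite big_ord_recr /= IH uphalf_half; have := odd_double_half J.
case: (odd J) => /= JE; rewrite ?add0n ?add1n.
  by rewrite [X in _ = _ + X]big_ord_recr /= add1n -[in t J]JE add1n addrA.
by rewrite [X in _ = X + _]big_ord_recr /= add0n -[in t J]JE add0n addrAC.
Qed.

(** The level where the search stands when it turns to block [j].  For [j >= 2]
    it is the last level of block [j - 2], so that all levels of block [j - 1] are
    available to branch towards the candidates at level [2 ^ j]. *)
Definition start (j : nat) : nat := if j is j'.+1 then (2 ^ j' - 1)%N else 0%N.

Lemma start_le i j : (i <= j)%N -> (start i <= start j)%N.
Proof.
case: i => [//|i]; case: j => [//|j]; rewrite ltnS => ij /=.
by apply: leq_sub2r; rewrite leq_pexp2l.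
Qed.

Lemma start_lt j : (start j < 2 ^ j)%N.
Proof. by case: j => [//|j] /=; rewrite expnS; have := expn_gt0 2 j; lia. Qed.

Lemma start_gap j : (2 ^ j <= 2 * (2 ^ j - start j))%N.
Proof. by case: j => [//|j] /=; rewrite expnS; have := expn_gt0 2 j; lia. Qed.

Context {d : measure_display} {Omega : measurableType d}.
Variables (P : probability Omega R) (T : rooted_tree).
Variables (Z : T -> {RV P >-> R}) (alpha : nat -> R).
Hypothesis lf : locally_finite T.
Hypothesis ll : leafless T.
Hypothesis gZ : forall v, standard_gaussian (Z v).
Hypothesis indepZ : mutually_independent Z.
Variable D : R.
Hypothesis D_ge2 : 2 <= D.
Hypothesis D_le : forall w : T, D <= (nb_children w)%:R.
Implicit Types (u v : T).

Local Notation var := (var alpha).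
Local Notation Emin := (Emin Z alpha).

(** The order of magnitude of the maximum over block [j], without the factor
    depending on the degrees. *)
Definition dyadic j : R := Num.sqrt (2 ^+ j) * Num.sqrt (var (2 ^ j) (2 ^ j.+1)).

Lemma dyadic_ge0 j : 0 <= dyadic j.
Proof. by rewrite mulr_ge0// sqrtr_ge0. Qed.

Lemma dyadic_sqr j : dyadic j ^+ 2 = 2 ^+ j * var (2 ^ j) (2 ^ j.+1).
Proof. by rewrite /dyadic exprMn !sqr_sqrtr ?var_ge0 ?exprn_ge0. Qed.

Let t j := Num.sqrt (ln D) / 2 * dyadic j.

Let lnD_gt0 : 0 < ln D.
Proof. by rewrite ln_gt0//; apply: lt_le_trans D_ge2; lra. Qed.

Let t_ge0 j : 0 <= t j.
Proof. by rewrite mulr_ge0 ?dyadic_ge0// divr_ge0// sqrtr_ge0. Qed.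

(** There are at least [D ^+ m] candidates with [2 * m >= 2 ^ j], and [t j] is
    chosen so that [gaussian_tail] bounds the success probability of an arm below by
    [tail_cst * D ^- m].  Some candidate then succeeds with a probability bounded
    below, and [theta * t j <= 1] makes the gain linear in the exponent. *)
Lemma block_expectation theta phi v j n : 0 <= theta -> theta * t j <= 1 ->
  level v = start j ->
  (forall u, level u = start j.+2 -> (\int[P]_w Emin theta u n w <= phi%:E)%E) ->
  (\int[P]_w Emin theta v (2 ^ j - start j + (2 ^ j - 1) + n) w <=
   (expR (theta ^+ 2 / 2 * var (start j).+1 (2 ^ j.+1) -
     greedy_cst * (theta * t j)) * phi)%:E)%E.
Proof.
move=> th0 tht lv phiP.
set m := (2 ^ j - start j)%N; set e := (2 ^ j - 1)%N.
have sj := start_lt j.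
have j0 : (0 < 2 ^ j)%N by rewrite expn_gt0.
have L1 : (level v + m = 2 ^ j)%N by rewrite lv /m; lia.
have L2 : (level v + m + e = start j.+2)%N by rewrite L1 /e /= expnS; lia.
have L2S : (start j.+2).+1 = (2 ^ j.+1)%N by rewrite /= expnS; lia.
have m0 : (0 < m)%N by rewrite /m; lia.
pose s := desc v m; pose N := size s.
have D0 : 0 < D by apply: lt_le_trans D_ge2.
have DN : D ^+ m <= N%:R by apply: size_desc_ge => //; exact: ltW.
have N1 : (1 < N)%N.
  rewrite -(ler_nat R 2 N); apply: le_trans DN; apply: le_trans D_ge2 _.
  by apply: ler_eXnr => //; apply: le_trans D_ge2; rewrite ler1n.
pose tau := Num.sqrt (ln D) / 2 * Num.sqrt (2 ^+ j) : R.
have tau0 : 0 <= tau by rewrite mulr_ge0 ?divr_ge0 ?sqrtr_ge0.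
pose q := (@tail_cst R) * expR (- (2 * tau ^+ 2)).
have q0 : 0 <= q by rewrite mulr_ge0 ?expR_ge0// ltW// tail_cst_gt0.
have e1 : expR (- (2 * tau ^+ 2)) <= 1.
  by rewrite -[leRHS]expR0 ler_expR oppr_le0 mulr_ge0// sqr_ge0.
have q1 : q <= 1.
  by rewrite -[leRHS]mulr1 ler_pM ?expR_ge0 ?tail_cst_le1// ltW// tail_cst_gt0.
have tau2 : 2 * tau ^+ 2 <= m%:R * ln D.
  rewrite /tau !exprMn !sqr_sqrtr ?(ltW lnD_gt0) ?exprn_ge0//.
  have : (2 ^ j)%:R <= (2 * m)%:R :> R by rewrite ler_nat; exact: start_gap.
  rewrite natrX natrM => h.
  have := ler_wpM2r (ltW lnD_gt0) h; lra.
have qN : (@tail_cst R) <= q * N%:R.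
  rewrite /q -mulrA -[leLHS]mulr1 ler_wpM2l ?(ltW tail_cst_gt0)//.
  apply: (@le_trans _ _ (expR (- (m%:R * ln D)) * D ^+ m)).
    by rewrite expRN expRM_natl lnK ?posrE// mulVf// gt_eqF// exprn_gt0.
  by rewrite ler_pM ?expR_ge0 ?exprn_ge0 ?(ltW D0)// ler_expR lerN2.
have qP u : level u = (level v + m + e)%N ->
    (q%:E <= P [set w | (t j <= bsum Z alpha (level v + m) (level v + m + e).+1 u w)%R])%E.
  rewrite L2 L2S L1 => lu.
  have tE : t j = tau * Num.sqrt (var (2 ^ j) (2 ^ j.+1)) by rewrite /t /dyadic mulrA.
  have [v0|v0] := ltP 0 (var (2 ^ j) (2 ^ j.+1)).
    rewrite tE; apply: gaussian_tail => //; first exact: measurable_bsum.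
    by move=> l; apply: bsum_mgf => //; rewrite lu L2S.
  have {}v0 : var (2 ^ j) (2 ^ j.+1) = 0 by apply/eqP; rewrite eq_le v0 var_ge0.
  have -> : [set w | (t j <= bsum Z alpha (2 ^ j) (2 ^ j.+1) u w)%R] = setT.
    apply/seteqP; split => // w _ /=.
    by rewrite tE v0 sqrtr0 mulr0 (bsum_var0 _ _ _ v0).
  by rewrite probability_setT lee_fin.
have phiP' u : level u = (level v + m + e)%N -> (\int[P]_w Emin theta u n w <= phi%:E)%E.
  by rewrite L2; exact: phiP.
have us0 : desc v m != [::] by rewrite -size_eq0 -lt0n ltnW.
have := candidates_expectation lf ll gZ indepZ m0 phiP' th0 (t_ge0 j) q0 qP us0
  (uniq_desc lf v m) (fun _ h => h).
rewrite -/s -/N L2 L2S L1 lv => H.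
apply: (@le_trans _ _ (\int[P]_w minl ((candidate Z alpha ll theta v m e n)^~ w) s)%E).
  apply: ge0_le_integral => //.
  - by move=> w _; exact: Emin_ge0.
  - by apply: (@adapted_measurable _ _ _ _ _ Z _ _ setT); exact: adapted_Emin.
  - apply: (@adapted_measurable _ _ _ _ _ Z _ _ setT); apply: adapted_minl => u _.
    apply: emeasurable_funM; first exact: adapted_expR.
    by apply: emeasurable_funM; [exact: adapted_expR|exact: adapted_Emin].
  - by move=> w _; exact: Emin_le_candidates.
apply: le_trans H _; rewrite lee_fin.
have phi0 : 0 <= phi.
  have lu : level (iter (m + e) (heir ll) v) = start j.+2.
    by rewrite (desc_level lf (desc_heir lf ll v (m + e))) addnA.
  rewrite -lee_fin; apply: le_trans (phiP _ lu).
  by apply: integral_ge0 => w _; exact: Emin_ge0.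
have -> : var (start j).+1 (2 ^ j.+1) =
    var (start j).+1 (2 ^ j) + var (2 ^ j) (2 ^ j.+1).
  by apply: var_cat => //; rewrite leq_exp2l.
set x := theta * t j.
have -> : expR (theta ^+ 2 / 2 * (var (start j).+1 (2 ^ j) + var (2 ^ j) (2 ^ j.+1)) -
    greedy_cst * x) = expR (theta ^+ 2 / 2 * var (start j).+1 (2 ^ j)) *
    expR (theta ^+ 2 / 2 * var (2 ^ j) (2 ^ j.+1)) * expR (- (greedy_cst * x)).
  by rewrite -!expRD; congr expR; ring.
rewrite [leRHS]mulrAC [X in X * _ <= _]mulrAC ler_wpM2l//.
  by rewrite !mulr_ge0 ?expR_ge0.
have := success_ge N1 q0 q1 qN; set pi := _ ^+ _ => pi1.
have et := expRN_le (mulr_ge0 th0 (t_ge0 j)) tht.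
apply: le_trans (expR_ge1Dx _).
have x0 := mulr_ge0 th0 (t_ge0 j).
rewrite -/x in et x0.
have : 0 <= (expR (- ((@tail_cst R) / 2)) - pi) * (1 - expR (- x)).
  by rewrite mulr_ge0 ?subr_ge0//; lra.
have : 0 <= (1 - expR (- ((@tail_cst R) / 2))) * (1 - x / 2 - expR (- x)).
  rewrite mulr_ge0 ?subr_ge0// -[leRHS]expR0 ler_expR oppr_le0 divr_ge0//.
  exact: ltW tail_cst_gt0.
rewrite /greedy_cst; lra.
Qed.

(** The conclusion of [block_expectation] for block [j] has the form of its
    hypothesis for block [j - 2]; the induction runs from the last block to the
    first. *)
Lemma recursion_expectation theta n k : 0 <= theta ->
  forall j v, level v = start j -> (start (j + k.*2) <= n)%N ->
  (forall i, (i < k)%N -> theta * t (j + i.*2)%N <= 1) ->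
  (\int[P]_w Emin theta v (n - start j) w <=
   (expR (theta ^+ 2 / 2 * var (start j).+1 n.+1 -
     greedy_cst * (theta * \sum_(i < k) t (j + i.*2)%N)))%:E)%E.
Proof.
move=> th0; elim: k => [|k IH] j v lv jn tht.
  rewrite big_ord0 !mulr0 subr0; rewrite addn0 in jn.
  by have := Emin_expectation alpha lf ll gZ indepZ theta v (n - start j); rewrite lv subnKC.
have jn2 : (start j.+2 <= n)%N.
  by apply: leq_trans jn; apply: start_le; rewrite doubleS; lia.
have sj := start_lt j.
have S2 : start j.+2 = (2 ^ j + 2 ^ j - 1)%N by rewrite /= expnS mul2n addnn.
have -> : (n - start j = 2 ^ j - start j + (2 ^ j - 1) + (n - start j.+2))%N.
  rewrite S2 in jn2 *; lia.
apply: le_trans (block_expectation (phi := expR (theta ^+ 2 / 2 * var (start j.+2).+1 n.+1 -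
     greedy_cst * (theta * \sum_(i < k) t (j.+2 + i.*2)%N))) th0 _ lv _) _.
- by have := tht 0%N isT; rewrite addn0.
- move=> u lu; apply: IH => //.
    by apply: leq_trans jn; rewrite doubleS !addnS !addSn.
  by move=> i ik; have := tht i.+1 ik; rewrite doubleS !addnS !addSn.
rewrite lee_fin -expRD ler_expR.
have E2 : (start j.+2).+1 = (2 ^ j.+1)%N by rewrite S2 expnS; lia.
rewrite E2 [var (start j).+1 n.+1](@var_cat _ _ _ (2 ^ j.+1)); [|lia|lia].
rewrite big_ord_recl /= addn0.
have -> : \sum_(i < k) t (j + (bump 0 i).*2)%N = \sum_(i < k) t (j.+2 + i.*2)%N.
  by apply: eq_bigr => i _; rewrite /bump leq0n add1n doubleS !addnS !addSn.
lra.
Qed.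

Definition dyadic_sum J : R := \sum_(j < J) dyadic j.

Lemma dyadic_sum0 : dyadic_sum 0 = 0.
Proof. by rewrite /dyadic_sum big_ord0. Qed.

Lemma dyadic_sumS J : dyadic_sum J.+1 = dyadic_sum J + dyadic J.
Proof. by rewrite /dyadic_sum big_ord_recr. Qed.

Lemma dyadic_sum_ge0 J : 0 <= dyadic_sum J.
Proof. by apply: sumr_ge0 => j _; exact: dyadic_ge0. Qed.

Lemma var_le_dyadic_sum J : var 1 (2 ^ J) <= dyadic_sum J ^+ 2.
Proof.
elim: J => [|J IH]; first by rewrite dyadic_sum0 expn0 var_nil// expr0n.
rewrite (@var_cat _ _ _ (2 ^ J)%N); rewrite ?leq_exp2l ?expn_gt0//.
rewrite dyadic_sumS.
have h : var (2 ^ J) (2 ^ J.+1) <= dyadic J ^+ 2.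
  by rewrite dyadic_sqr ler_peMl ?var_ge0// exprn_ege1//; lra.
have := mulr_ge0 (dyadic_sum_ge0 J) (dyadic_ge0 J); nra.
Qed.

(** The denominators of the two constants come from balancing, in [small_ball], the
    linear gain against the variance and against the level of the ball. *)
Definition spread_cst : R := greedy_cst / 16.
Definition small_ball_cst : R := expR (- (greedy_cst ^+ 2 / 128)).

Lemma spread_cst_gt0 : 0 < spread_cst.
Proof. by rewrite divr_gt0//; exact: greedy_cst_gt0. Qed.

Lemma small_ball_cst_lt1 : small_ball_cst < 1.
Proof.
rewrite /small_ball_cst -[ltRHS]expR0 ltr_expR oppr_lt0 divr_gt0// exprn_gt0//.
exact: greedy_cst_gt0.
Qed.

Definition lower_cst : R := spread_cst * Num.sqrt ((1 - small_ball_cst) / 8) / 4.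

Lemma lower_cst_gt0 : 0 < lower_cst.
Proof.
rewrite divr_gt0// mulr_gt0 ?spread_cst_gt0// sqrtr_gt0 divr_gt0// subr_gt0.
exact: small_ball_cst_lt1.
Qed.

(** Chernoff's bound: on [B] the integrand [Emin] is at least
    [expR (- (theta * x))].  One parity class carries half of the sum, and [theta]
    is the inverse of that half up to a constant, small enough for the gain, which
    is linear in the constant, to exceed the quadratic variance term. *)
Lemma small_ball J x (B : set Omega) : measurable B ->
  0 < dyadic_sum J -> x <= spread_cst * Num.sqrt (ln D) * dyadic_sum J ->
  (forall w u, B w -> u \in desc (Defs.root T) (2 ^ J - 1) ->
    bsum Z alpha 1 (2 ^ J) u w <= x) ->
  (P B <= small_ball_cst%:E)%E.
Proof.
move=> mB S0 xS BP.
have c0 := greedy_cst_gt0; have c1 := greedy_cst_le1.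
set n := (2 ^ J - 1)%N.
have nS : n.+1 = (2 ^ J)%N by rewrite /n; have := expn_gt0 2 J; lia.
have sD0 : 0 < Num.sqrt (ln D) by rewrite sqrtr_gt0.
have tS : \sum_(i < J) t i = Num.sqrt (ln D) / 2 * dyadic_sum J.
  by rewrite /t -mulr_sumr.
(* One of the two parity classes carries half of the sum. *)
have [j [k [sj jk Uge tU]]] : exists j k, [/\ start j = 0%N, (start (j + k.*2) <= n)%N,
    Num.sqrt (ln D) / 4 * dyadic_sum J <= \sum_(i < k) t (j + i.*2)%N &
    forall i, (i < k)%N -> t (j + i.*2)%N <= \sum_(i < k) t (j + i.*2)%N].
  have tle j k i : (i < k)%N -> t (j + i.*2)%N <= \sum_(i < k) t (j + i.*2)%N.
    move=> ik; rewrite (bigD1 (Ordinal ik))//= lerDl.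
    by apply: sumr_ge0 => ? _; exact: t_ge0.
  have := parity_sum t J; rewrite tS.
  set a := \sum_(i < uphalf J) _; set b := \sum_(i < J./2) _ => ab.
  have [le_ab|lt_ba] := lerP b a.
    exists 0%N, (uphalf J); split => //; last 2 first.
    - by rewrite -/a; lra.
    - exact: tle.
    apply: leq_trans (_ : start J.+1 <= _)%N; last by rewrite /n.
    by apply: start_le; rewrite add0n uphalf_half; have := odd_double_half J; lia.
  exists 1%N, J./2; split => //; last 2 first.
  - by rewrite -/b; lra.
  - exact: tle.
  apply: leq_trans (_ : start J.+1 <= _)%N; last by rewrite /n.
  by apply: start_le; have := odd_double_half J; lia.
set U := \sum_(i < k) _ in Uge tU.
have U0 : 0 < U by apply: lt_le_trans Uge; rewrite mulr_gt0// divr_gt0.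
(* With c the greedy constant, the exponent is at most
   c^2 / 128 + c^2 / 64 - c^2 / 32 = - c^2 / 128. *)
pose delta := greedy_cst / 32; pose theta := delta / U.
have d0 : 0 < delta by rewrite divr_gt0.
have th0 : 0 <= theta by rewrite divr_ge0// ltW.
have thU : theta * U = delta by rewrite /theta divfK// gt_eqF.
have tht i : (i < k)%N -> theta * t (j + i.*2)%N <= 1.
  move=> ik; apply: le_trans (_ : theta * U <= _); first by rewrite ler_wpM2l// tU.
  by rewrite thU /delta; lra.
have lr : level (Defs.root T) = start j by rewrite level_root sj.
have H := recursion_expectation th0 lr jk tht.
rewrite -/U thU sj subn0 nS in H.
have Hv : theta ^+ 2 / 2 * var 1 (2 ^ J) <= 16 * delta ^+ 2.
  have SU : dyadic_sum J ^+ 2 <= 32 * U ^+ 2.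
    have lnD2 : 1 / 2 <= ln D.
      by apply: le_trans ln2_ge _; rewrite ler_ln ?posrE//; apply: lt_le_trans D_ge2.
    have : (Num.sqrt (ln D) / 4 * dyadic_sum J) ^+ 2 <= U ^+ 2.
      by rewrite ler_sqr ?nnegrE ?(ltW U0)// mulr_ge0 ?divr_ge0 ?sqrtr_ge0 ?dyadic_sum_ge0.
    rewrite !exprMn sqr_sqrtr ?(ltW lnD_gt0)// => h.
    have := ler_wpM2r (sqr_ge0 (dyadic_sum J)) lnD2; lra.
  have -> : delta ^+ 2 = theta ^+ 2 * U ^+ 2 by rewrite -exprMn thU.
  have := ler_wpM2l (sqr_ge0 theta) (le_trans (var_le_dyadic_sum J) SU); lra.
have thx : theta * x <= greedy_cst ^+ 2 / 128.
  apply: le_trans (_ : theta * (greedy_cst / 16 * (4 * U)) <= _).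
    rewrite ler_wpM2l//; apply: le_trans xS _.
    have -> : spread_cst * Num.sqrt (ln D) * dyadic_sum J =
      greedy_cst / 16 * (4 * (Num.sqrt (ln D) / 4 * dyadic_sum J)).
      by rewrite /spread_cst; field.
    apply: ler_wpM2l; first by apply: divr_ge0 => //; exact: ltW.
    exact: ler_wpM2l.
  have -> : theta * (greedy_cst / 16 * (4 * U)) = theta * U * (greedy_cst / 4) by field.
  by rewrite thU /delta; lra.
have PB : ((expR (- (theta * x)))%:E * P B <= \int[P]_w Emin theta (Defs.root T) n w)%E.
  rewrite -[B in P B]setIT -integral_indic// -ge0_integralZl//; last by apply/measurable_EFinP.
  apply: ge0_le_integral => //.
  - by apply: emeasurable_funM => //; apply/measurable_EFinP.
  - by apply: (@adapted_measurable _ _ _ _ _ Z _ _ setT); exact: adapted_Emin.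
  - move=> w _; rewrite indicE; case: (boolP (w \in B)) => wB.
      rewrite mule1; apply: le_minl => u ur.
      rewrite level_root add0n nS lee_fin ler_expR mulNr lerN2 ler_wpM2l//.
      by apply: BP => //; move: wB; rewrite inE.
    by rewrite mule0; exact: Emin_ge0.
rewrite -(fineK (fin_num_measure P B mB)) in PB *.
have := le_trans PB H; rewrite -EFinM !lee_fin => {}H.
rewrite /small_ball_cst.
have : fine (P B) <= expR (theta * x + (theta ^+ 2 / 2 * var 1 (2 ^ J) - greedy_cst * delta)).
  rewrite expRD; have := ler_wpM2l (expR_ge0 (theta * x)) H.
  by rewrite mulrA -[X in X * _ <= _]expRD subrr expR0 mul1r.
move=> /le_trans; apply; rewrite ler_expR.
by rewrite /delta in Hv *; lra.
Qed.

End greedy_recursion.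

(** * Chaining over dyadic blocks *)

Section chaining.
Context {R : realType} {d : measure_display} {Omega : measurableType d}.
Variables (P : probability Omega R) (T : rooted_tree).
Variables (Z : T -> {RV P >-> R}) (alpha : nat -> R).
Hypothesis lf : locally_finite T.
Hypothesis gZ : forall v, standard_gaussian (Z v).
Hypothesis indepZ : mutually_independent Z.
Variable D : R.
Hypothesis D_ge2 : 2 <= D.
Hypothesis D_ge : forall w : T, (nb_children w)%:R <= D.
Implicit Types (u v : T) (w : Omega).

Local Notation r := (Defs.root T).
Local Notation bsum := (bsum Z alpha).
Local Notation var := (var alpha).
Local Notation dyadic := (dyadic alpha).

Let lnD_gt0 : 0 < ln D.
Proof. by rewrite ln_gt0//; apply: lt_le_trans D_ge2; rewrite ltr1n. Qed.

Let D_gt0 : 0 < D. Proof. exact: lt_le_trans D_ge2. Qed.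

Definition generations j : seq T := flatten [seq desc r n | n <- index_iota (2 ^ j) (2 ^ j.+1)].

Lemma generationsP j u : (2 ^ j <= level u < 2 ^ j.+1)%N -> u \in desc r (level u) ->
  u \in generations j.
Proof.
move=> lu ud; apply/flattenP; exists (desc r (level u)) => //.
by apply/mapP; exists (level u) => //; rewrite mem_index_iota.
Qed.

Lemma generations_level j u : u \in generations j -> (level u < 2 ^ j.+1)%N.
Proof.
move=> /flattenP[_ /mapP[n + ->]]; rewrite mem_index_iota => /andP[_ nj].
by move=> /(desc_level lf) ->; rewrite level_root add0n.
Qed.

(** The degrees are at least two, so the sizes of the levels grow geometrically. *)
Lemma size_generations j : (size (generations j))%:R <= D ^+ (2 ^ j.+1).
Proof.
rewrite /generations size_flatten /shape -map_comp sumnE big_map natr_sum.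
have geo a b : (a <= b)%N -> \sum_(a <= n < b) D ^+ n <= D ^+ b.
  elim: b => [|b IH]; first by rewrite leqn0 => /eqP ->; rewrite big_geq// expr0.
  rewrite leq_eqVlt => /orP[/eqP ->|]; first by rewrite big_geq// exprn_ge0// ltW.
  rewrite ltnS => ab; rewrite big_nat_recr//= exprS.
  have := IH ab; have := ler_wpM2r (exprn_ge0 b (ltW D_gt0)) D_ge2; lra.
apply: le_trans (geo (2 ^ j)%N _ _); last by rewrite leq_exp2l.
by apply: ler_sum => n _ /=; apply: size_desc_le => //; exact: ltW.
Qed.

Let L j : R := 2 ^+ j.+1 * ln D.

Let L_ge1 j : 1 <= L j.
Proof.
have lnD2 : 1 / 2 <= ln D.
  by apply: le_trans ln2_ge _; rewrite ler_ln ?posrE.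
apply: le_trans (_ : 2 * ln D <= _); first lra.
by apply: ler_wpM2r; [exact: ltW|rewrite ler_eXnr// ler1n].
Qed.

Let b2 j : R := var (2 ^ j) (2 ^ j.+1).

Let lam j : R := 2 * Num.sqrt (L j) / Num.sqrt (b2 j).

Let S j u : Omega -> R := bsum (2 ^ j) (level u).+1 u.

(** A majorant of the squares of all partial sums over block [j]
    ([block_le_envelope]).  Exponentials of both signs replace the maximum of
    absolute values, so that the expectation follows from [bsum_mgf]. *)
Definition envelope j w : R := b2 j * L j * (4 + \sum_(u <- generations j)
  expR (- (3 * L j)) * (expR (lam j * S j u w) + expR (- lam j * S j u w))).

Lemma envelope_ge0 j w : 0 <= envelope j w.
Proof.
apply: mulr_ge0; first by rewrite mulr_ge0 ?var_ge0 ?(le_trans ler01 (L_ge1 j)).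
rewrite addr_ge0//; apply: sumr_ge0 => u _.
by rewrite mulr_ge0 ?addr_ge0 ?expR_ge0.
Qed.

(** Used with [x] a normalized partial sum: an exponential moment then controls the
    square.  The cubic lower bound for the exponential suffices. *)
Lemma sqr_le_expR (l x : R) : 1 <= l -> 0 <= x ->
  x ^+ 2 <= 4 + expR (l * (2 * x - 3)).
Proof.
move=> l1 x0; have [h|h] := lerP (2 * x) 3.
  by have := expR_ge0 (l * (2 * x - 3)); nra.
have h1 : expR (2 * x - 3) <= expR (l * (2 * x - 3)).
  by rewrite ler_expR; rewrite ler_peMl//; lra.
have h2 : (1 + (2 * x - 3) / 3) ^+ 3 <= expR (2 * x - 3).
  have -> : expR (2 * x - 3) = expR ((2 * x - 3) / 3) ^+ 3.
    by rewrite -expRM_natl; congr expR; field.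
  apply: lerXn2r; rewrite ?nnegrE ?expR_ge0//; first lra.
  exact: expR_ge1Dx.
set y := 2 * x - 3 in h1 h2 *; have y0 : 0 < y by rewrite /y; lra.
have -> : x = (y + 3) / 2 by rewrite /y; field.
have h3 : 1 + y + y ^+ 2 / 3 <= (1 + y / 3) ^+ 3.
  rewrite -subr_ge0 (_ : _ - _ = y ^+ 3 / 27); last by field.
  by rewrite divr_ge0// exprn_ge0// ltW.
have := sqr_ge0 (y - 3); lra.
Qed.

Lemma le_sum_mem (I : eqType) (s : seq I) (F : I -> R) i :
  (forall k, 0 <= F k) -> i \in s -> F i <= \sum_(k <- s) F k.
Proof.
move=> F0; elim: s => [//|k s IH]; rewrite inE big_cons => /orP[/eqP ->|/IH h].
  by rewrite lerDl; apply: sumr_ge0.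
by apply: le_trans h _; rewrite lerDr.
Qed.

Lemma block_le_envelope j u w : (2 ^ j <= level u < 2 ^ j.+1)%N ->
  u \in desc r (level u) -> S j u w ^+ 2 <= envelope j w.
Proof.
move=> lu ud; have uG := generationsP lu ud.
have [v0|v0] := eqVneq (b2 j) 0.
  rewrite {1}/S (bsum_var0 _ _ _ v0); first by rewrite expr0n envelope_ge0.
  by case/andP: lu.
have vgt0 : 0 < b2 j by rewrite lt_neqAle eq_sym v0 var_ge0.
have Lgt0 : 0 < L j by apply: lt_le_trans (L_ge1 j).
set M := Num.sqrt (b2 j * L j).
have M2 : M ^+ 2 = b2 j * L j by rewrite sqr_sqrtr// mulr_ge0// ltW.
have M0 : 0 < M by rewrite sqrtr_gt0 mulr_gt0.
rewrite /envelope -M2 -[S j u w](divfK (lt0r_neq0 M0)) mulrC exprMn ler_wpM2l ?sqr_ge0//.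
rewrite -[leLHS]real_normK ?num_real// normrM normfV (ger0_norm (ltW M0)).
apply: le_trans (sqr_le_expR (L_ge1 j) _) _; first by rewrite divr_ge0// ltW.
rewrite lerD2l.
have E : L j * (2 * (`|S j u w| / M) - 3) = - (3 * L j) + lam j * `|S j u w|.
  have sb : Num.sqrt (b2 j) != 0 by rewrite gt_eqF// sqrtr_gt0.
  have sL : Num.sqrt (L j) != 0 by rewrite gt_eqF// sqrtr_gt0.
  rewrite /lam /M sqrtrM ?(ltW vgt0)//.
  have La : L j = Num.sqrt (L j) ^+ 2 by rewrite sqr_sqrtr// ltW.
  set a := Num.sqrt (L j) in La sL *; set b := Num.sqrt (b2 j) in sb *.
  by rewrite La; field; rewrite sb sL.
rewrite E expRD.
apply: le_trans (le_sum_mem (F := fun v => expR (- (3 * L j)) *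
  (expR (lam j * S j v w) + expR (- lam j * S j v w))) _ uG); last first.
  by move=> v; rewrite mulr_ge0 ?addr_ge0 ?expR_ge0.
rewrite ler_wpM2l ?expR_ge0//.
have [s0|s0] := lerP 0 (S j u w).
  by rewrite (ger0_norm s0) lerDl expR_ge0.
by rewrite (ltr0_norm s0) mulrN mulNr lerDr expR_ge0.
Qed.

Lemma measurable_envelope j : measurable_fun setT (envelope j).
Proof.
apply: measurable_funM => //; apply: measurable_funD => //.
apply: measurable_sum => u; apply: measurable_funM => //.
by apply: measurable_funD; apply: measurableT_comp => //; apply: measurable_funM => //;
  exact: measurable_bsum.
Qed.

(** The square root of the bound for the expectation of [envelope]. *)
Definition weight j : R := Num.sqrt (12 * ln D) * dyadic j.

Lemma weight_ge0 j : 0 <= weight j.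
Proof. by rewrite mulr_ge0 ?sqrtr_ge0 ?dyadic_ge0. Qed.

Lemma weight2 j : weight j ^+ 2 = 6 * (b2 j * L j).
Proof.
rewrite /weight exprMn dyadic_sqr sqr_sqrtr; first by rewrite /L /b2 exprS; ring.
by rewrite mulr_ge0// ltW.
Qed.

(** Each exponential has expectation at most [expR (2 * L j)], there are at most
    [expR (L j)] of them, and the factor [expR (- (3 * L j))] compensates both. *)
Lemma envelope_expectation j :
  (\int[P]_w (envelope j w)%:E <= (weight j ^+ 2)%:E)%E.
Proof.
have b0 : 0 <= b2 j by exact: var_ge0.
have Lgt0 : 0 < L j by apply: lt_le_trans (L_ge1 j).
have e0 k u w : (0 <= (expR (k * S j u w))%:E)%E by rewrite lee_fin expR_ge0.
have me k u : measurable_fun setT (fun w => (expR (k * S j u w))%:E).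
  by apply/measurable_EFinP; apply: measurableT_comp => //; apply: measurable_funM => //;
    exact: measurable_bsum.
have mterm u : measurable_fun setT (fun w => (expR (- (3 * L j)) *
    (expR (lam j * S j u w) + expR (- lam j * S j u w)))%:E).
  apply/measurable_EFinP; apply: measurable_funM => //.
  by apply: measurable_funD; apply: measurableT_comp => //; apply: measurable_funM => //;
    exact: measurable_bsum.
have mS k u : u \in generations j -> k ^+ 2 = lam j ^+ 2 ->
    (\int[P]_w (expR (k * S j u w))%:E <= (expR (2 * L j))%:E)%E.
  move=> uG kl; rewrite /S (bsum_mgf alpha gZ indepZ)// lee_fin ler_expR kl.
  have vle : var (2 ^ j) (level u).+1 <= b2 j.
    have [h|h] := leqP (2 ^ j) (level u).+1.
      rewrite /b2 (@var_cat _ _ (2 ^ j) (level u).+1 (2 ^ j.+1))// ?lerDl ?var_ge0//.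
      exact: generations_level.
    by rewrite var_nil ?var_ge0// ltnW.
  apply: le_trans (_ : lam j ^+ 2 / 2 * b2 j <= _).
    by rewrite ler_wpM2l// divr_ge0// sqr_ge0.
  rewrite /lam !exprMn exprVn !sqr_sqrtr ?(ltW Lgt0)//.
  have [->|v0] := eqVneq (b2 j) 0; first by rewrite mulr0 mulr_ge0// ltW.
  by have -> : 2 ^+ 2 * L j / b2 j / 2 * b2 j = 2 * L j by field.
have -> : (\int[P]_w (envelope j w)%:E = (b2 j * L j)%:E * (4%:E + \sum_(u <- generations j)
    (expR (- (3 * L j)))%:E * (\int[P]_w (expR (lam j * S j u w))%:E +
      \int[P]_w (expR (- lam j * S j u w))%:E)))%E.
  under eq_integral do rewrite /envelope EFinM EFinD -sumEFin.
  rewrite ge0_integralZl//.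
  - congr (_ * _)%E; rewrite ge0_integralD//.
    + have i4 : (\int[P]_w 4%:E = 4%:E :> \bar R)%E.
        by rewrite integral_cst// -[RHS]mule1 -(@probability_setT _ _ _ P).
      rewrite i4; congr (_ + _)%E.
      rewrite ge0_integral_sum//.
      apply: eq_bigr => u _; under eq_integral do rewrite EFinM EFinD.
      rewrite ge0_integralZl//.
      * by rewrite ge0_integralD.
      * by apply: emeasurable_funD.
      * by move=> w _; rewrite adde_ge0.
    + by move=> w _; apply: sume_ge0 => u _; rewrite lee_fin mulr_ge0 ?addr_ge0 ?expR_ge0.
    + apply: emeasurable_sum => u; exact: mterm.
  - apply: emeasurable_funD => //.
    apply: emeasurable_sum => u; exact: mterm.
  - move=> w _; rewrite adde_ge0//.
    by apply: sume_ge0 => u _; rewrite lee_fin mulr_ge0 ?addr_ge0 ?expR_ge0.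
  - by rewrite lee_fin mulr_ge0// ltW.
rewrite weight2 [6 * _]mulrC; set c := b2 j * L j.
have c0 : 0 <= c by rewrite mulr_ge0// ltW.
rewrite (EFinM c) lee_wpmul2l ?lee_fin//.
apply: le_trans (_ : 4%:E + \sum_(u <- generations j)
    (expR (- (3 * L j)) * (2 * expR (2 * L j)))%:E <= _)%E.
  apply: leeD => //; rewrite big_seq [leRHS]big_seq; apply: lee_sum => u uG.
  rewrite EFinM lee_wpmul2l ?lee_fin ?expR_ge0// mulr_natl mulr2n EFinD.
  by apply: leeD; apply: mS => //; rewrite sqrrN.
rewrite sumEFin -EFinD lee_fin big_const_seq count_predT iter_addr_0 -[X in _ + X]mulr_natl.
have : expR (- L j) * (size (generations j))%:R <= 1.
  rewrite expRN ler_pdivrMl ?expR_gt0// mulr1; apply: le_trans (size_generations j) _.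
  by rewrite -{1}[D]lnK ?posrE// -expRM_natl /L natrX.
have -> : (size (generations j))%:R * (expR (- (3 * L j)) * (2 * expR (2 * L j))) =
    2 * (expR (- L j) * (size (generations j))%:R).
  have -> : expR (- L j) = expR (- (3 * L j)) * expR (2 * L j) by rewrite -expRD;
    congr expR; ring.
  by ring.
lra.
Qed.

Lemma weight0_envelope j w : weight j = 0 -> envelope j w = 0.
Proof.
move=> w0; have := weight2 j; rewrite w0 expr0n /= => /esym/eqP.
by rewrite mulf_eq0 pnatr_eq0 /= => /eqP b0; rewrite /envelope b0 mul0r.
Qed.

(** The inductive step of the weighted Cauchy-Schwarz inequality; a block of weight
    [0] contributes nothing, in accordance with the convention [h / 0 = 0]. *)
Lemma weighted_sqrD (A y W w B h : R) : 0 <= W -> 0 <= w -> 0 <= B -> 0 <= h ->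
  (w = 0 -> h = 0) -> A ^+ 2 <= W * B -> y ^+ 2 <= h ->
  (A + y) ^+ 2 <= (W + w) * (B + h / w).
Proof.
move=> W0 w0 B0 h0 wh AB yh; have [wz|wn] := eqVneq w 0.
  have y0 : y = 0 by apply/eqP; rewrite -sqrf_eq0 eq_le sqr_ge0 andbT -(wh wz).
  by rewrite y0 wz invr0 mulr0 !addr0.
have wgt0 : 0 < w by rewrite lt_neqAle eq_sym wn.
have [Wz|Wn] := eqVneq W 0.
  have A0 : A = 0 by apply/eqP; rewrite -sqrf_eq0 eq_le sqr_ge0 andbT; move: AB;
    rewrite Wz mul0r.
  rewrite A0 Wz !add0r mulrDr mulrCA divff// mulr1.
  by have := mulr_ge0 w0 B0; lra.
have Wgt0 : 0 < W by rewrite lt_neqAle eq_sym Wn.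
have AB' : A ^+ 2 / W <= B by rewrite ler_pdivrMr// mulrC.
apply: le_trans (_ : (W + w) * (A ^+ 2 / W + y ^+ 2 / w) <= _); last first.
  rewrite ler_wpM2l ?addr_ge0// lerD// ler_wpM2r// invr_ge0//.
rewrite -subr_ge0.
have -> : (W + w) * (A ^+ 2 / W + y ^+ 2 / w) - (A + y) ^+ 2 = (w * A - W * y) ^+ 2 / (W * w).
  by field; rewrite wn Wn.
by rewrite divr_ge0 ?sqr_ge0// mulr_ge0.
Qed.

(** Block by block, a branch is cut at the levels [2 ^ j] and the squares of the
    increments are recombined by [weighted_sqrD]. *)
Lemma chain_finite J K u w : (J <= K)%N -> (level u < 2 ^ K)%N -> u \in desc r (level u) ->
  bsum (2 ^ J) (level u).+1 u w ^+ 2 <=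
  (\sum_(J <= j < K) weight j) * (\sum_(J <= j < K) envelope j w / weight j).
Proof.
have s0 a b : 0 <= \sum_(a <= j < b) weight j by apply: sumr_ge0 => j _; exact: weight_ge0.
have t0 a b : 0 <= \sum_(a <= j < b) envelope j w / weight j.
  by apply: sumr_ge0 => j _; rewrite divr_ge0 ?weight_ge0 ?envelope_ge0.
elim: K u => [|K IH] u; first by rewrite leqn0 => /eqP -> lu _;
  rewrite bsum_nil// expr0n mulr_ge0.
have [luK|luK] := ltnP (level u) (2 ^ K).
  rewrite leq_eqVlt => /orP[/eqP JK|].
    move=> _ _; rewrite JK [X in X ^+ 2](_ : _ = 0); last first.
      by apply: bsum_nil; apply: leq_trans luK _; rewrite leq_exp2l.
    by rewrite expr0n mulr_ge0.
  rewrite ltnS => JK _ ud; apply: le_trans (IH u JK luK ud) _.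
  rewrite [X in _ <= X * _]big_nat_recr// [X in _ <= _ * X]big_nat_recr//=.
  by apply: ler_pM => //; rewrite lerDl ?divr_ge0 ?weight_ge0 ?envelope_ge0.
rewrite leq_eqVlt => /orP[/eqP JK|].
  move=> lu _; rewrite [X in X ^+ 2](_ : _ = 0); last by rewrite bsum_nil// JK.
  by rewrite expr0n mulr_ge0.
rewrite ltnS => JK lu ud.
have K0 : (0 < 2 ^ K)%N by rewrite expn_gt0.
set x := anc (2 ^ K - 1) u.
have lx : level x = (2 ^ K - 1)%N by rewrite level_anc//; lia.
have lxS : (level x).+1 = (2 ^ K)%N by rewrite lx; lia.
rewrite (bsum_cat _ _ _ _ (b := 2 ^ K)); [|by rewrite leq_exp2l|exact: leqW].
rewrite [X in (X + _) ^+ 2](_ : _ = bsum (2 ^ J) (level x).+1 x w); last first.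
  rewrite lxS; apply: eq_bsum => k /andP[_ kK]; rewrite /x anc_anc//; lia.
rewrite [X in _ <= X * _]big_nat_recr// [X in _ <= _ * X]big_nat_recr//=.
apply: weighted_sqrD => //.
- exact: weight_ge0.
- exact: envelope_ge0.
- exact: weight0_envelope.
- apply: IH => //; first by rewrite lx; lia.
  by rewrite lx; apply: desc_root_anc => //; lia.
- by apply: block_le_envelope => //; rewrite luK.
Qed.

Local Open Scope ereal_scope.

Definition tail_weight J : \bar R := \sum_(J <= j <oo) (weight j)%:E.

Definition tail_envelope J w : \bar R := \sum_(J <= j <oo) (envelope j w / weight j)%:E.

Let ratio_ge0 j w : 0 <= (envelope j w / weight j)%:E.
Proof. by rewrite lee_fin divr_ge0 ?weight_ge0 ?envelope_ge0. Qed.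

Lemma tail_weight_ge0 J : 0 <= tail_weight J.
Proof. by apply: nneseries_ge0 => j _ _; rewrite lee_fin weight_ge0. Qed.

Lemma tail_envelope_ge0 J w : 0 <= tail_envelope J w.
Proof. by apply: nneseries_ge0 => j _ _; exact: ratio_ge0. Qed.

Lemma chain_bound J u w : u \in desc r (level u) ->
  (bsum (2 ^ J) (level u).+1 u w ^+ 2)%:E <= tail_weight J * tail_envelope J w.
Proof.
move=> ud; pose K := maxn J (level u).
have lK : (level u < 2 ^ K)%N.
  by apply: (@leq_trans (2 ^ level u)); [exact: ltn_expl|rewrite leq_exp2l// leq_maxr].
apply: le_trans (_ : (\sum_(J <= j < K) (weight j)%:E) *
    (\sum_(J <= j < K) (envelope j w / weight j)%:E) <= _).
  by rewrite !sumEFin -EFinM lee_fin; apply: chain_finite => //; exact: leq_maxl.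
apply: lee_pmul.
- by apply: sume_ge0 => j _; rewrite lee_fin weight_ge0.
- by apply: sume_ge0 => j _; exact: ratio_ge0.
- by apply: nneseries_lim_ge => j _ _; rewrite lee_fin weight_ge0.
- by apply: nneseries_lim_ge => j _ _; exact: ratio_ge0.
Qed.

Lemma measurable_tail_envelope J : measurable_fun setT (tail_envelope J).
Proof.
rewrite /tail_envelope.
under eq_fun do rewrite -(nneseries_addn J (fun j => ratio_ge0 j _)).
apply: ge0_emeasurable_sum => [j w _ _|j _]; first exact: ratio_ge0.
by apply/measurable_EFinP; apply: measurable_funM => //; exact: measurable_envelope.
Qed.

Lemma tail_envelope_expectation J :
  \int[P]_w tail_envelope J w <= tail_weight J.
Proof.
under eq_integral do rewrite /tail_envelope -(nneseries_addn J (fun j => ratio_ge0 j _)).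
rewrite integral_nneseries//; last first.
  move=> j; apply/measurable_EFinP; apply: measurable_funM => //; exact: measurable_envelope.
rewrite /tail_weight -nneseries_addn; last by move=> j; rewrite lee_fin weight_ge0.
apply: lee_nneseries => [j _ _|j _]; first by apply: integral_ge0 => w _; exact: ratio_ge0.
set k := (j + J)%N.
under eq_integral do rewrite EFinM muleC.
rewrite ge0_integralZl//; last 3 first.
- by apply/measurable_EFinP; exact: measurable_envelope.
- by move=> w _; rewrite lee_fin envelope_ge0.
- by rewrite lee_fin invr_ge0 weight_ge0.
apply: le_trans (_ : (weight k)^-1%:E * (weight k ^+ 2)%:E <= _).
  by rewrite lee_wpmul2l ?lee_fin ?invr_ge0 ?weight_ge0//; exact: envelope_expectation.
rewrite -EFinM lee_fin; have [->|w0] := eqVneq (weight k) 0%R; first by rewrite invr0 mul0r.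
by rewrite expr2 mulrA mulVf// mul1r.
Qed.

End chaining.

(** * Comparison of the dyadic sums with Q *)

Section dyadic_series.
Context {R : realType}.
Variable alpha : nat -> R.
Hypothesis alpha_l2 : (\sum_(1 <= k <oo) (alpha k ^+ 2)%:E < +oo)%E.

Local Notation var := (var alpha).
Local Notation dyadic := (dyadic alpha).
Local Notation dyadic_sum := (dyadic_sum alpha).

Definition remainder l : R := fine (\sum_(l.+1 <= k <oo) (alpha k ^+ 2)%:E)%E.

Let sq_ge0 k : (0 <= (alpha k ^+ 2)%:E)%E.
Proof. by rewrite lee_fin sqr_ge0. Qed.

Let rest_split l n : (\sum_(l.+1 <= k <oo) (alpha k ^+ 2)%:E =
  (var l.+1 (l.+1 + n))%:E + \sum_(l.+1 + n <= k <oo) (alpha k ^+ 2)%:E)%E.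
Proof. by rewrite (nneseries_split _ n)// sumEFin. Qed.

Let rest_fin l : (\sum_(l.+1 <= k <oo) (alpha k ^+ 2)%:E)%E \is a fin_num.
Proof.
rewrite ge0_fin_numE; last by apply: nneseries_ge0 => k _ _; exact: sq_ge0.
apply: le_lt_trans alpha_l2; rewrite (rest_split 0 l) addeC -addn1 addnC.
by rewrite leeDl// lee_fin var_ge0.
Qed.

Lemma remainderE l : ((remainder l)%:E = \sum_(l.+1 <= k <oo) (alpha k ^+ 2)%:E)%E.
Proof. by rewrite /remainder fineK. Qed.

Lemma remainder_ge0 l : 0 <= remainder l.
Proof. by apply: fine_ge0; apply: nneseries_ge0 => k _ _; exact: sq_ge0. Qed.

Lemma remainder_split l n : (l < n)%N -> remainder l = var l.+1 n + remainder n.-1.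
Proof.
move=> ln; apply: EFin_inj; rewrite EFinD !remainderE (rest_split l (n - l.+1)).
by rewrite subnKC// prednK//; apply: leq_ltn_trans ln.
Qed.

Lemma remainder_cvg0 : remainder n @[n --> \oo] --> 0.
Proof.
have h : (\sum_(0 <= k <oo) (alpha k ^+ 2)%:E < +oo)%E.
  rewrite (nneseries_split _ 1)// add0n lte_add_pinfty// big_nat1.
  exact: ltry.
have := nneseries_tail_cvg h (fun k _ => sq_ge0 k).
rewrite -(cvg_shiftS (fun N => \sum_(N <= k <oo) (alpha k ^+ 2)%:E)%E) /=.
under eq_cvg do rewrite -remainderE.
by move=> /fine_cvgP[].
Qed.

Definition Qterm l : R := Num.sqrt (l.+1%:R^-1 * remainder l).

Lemma QE : Q alpha = (\sum_(0 <= l <oo) (Qterm l)%:E)%E.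
Proof. by apply: eq_eseriesr => l _; rewrite -remainderE -EFinM. Qed.

Lemma Qterm_ge0 l : 0 <= Qterm l. Proof. exact: sqrtr_ge0. Qed.

Lemma mulr_sqrtV (p v : R) : 0 < p -> p * Num.sqrt (p^-1 * v) = Num.sqrt p * Num.sqrt v.
Proof.
move=> p0; have s0 : Num.sqrt p != 0 by rewrite gt_eqF// sqrtr_gt0.
rewrite sqrtrM ?invr_ge0 ?(ltW p0)// sqrtrV ?(ltW p0)// mulrA; congr (_ * _).
by rewrite -[X in X / _](sqr_sqrtr (ltW p0)) expr2 mulfK.
Qed.

Let half_pow j : nat := if j is j'.+1 then (2 ^ j')%N else 0%N.

(** At least [2 ^ j / 2] indices [l] are summed; for each of them [l.+1 <= 2 ^ j]
    and the remainder contains the whole block [j]. *)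
Lemma dyadic_le_Qterm j :
  dyadic j <= 2 * \sum_(half_pow j <= l < 2 ^ j) Qterm l.
Proof.
have v0 : 0 <= var (2 ^ j) (2 ^ j.+1) by exact: var_ge0.
have p0 : 0 < (2 ^ j)%:R :> R by rewrite ltr0n expn_gt0.
have h0 : (2 ^ j <= 2 * (2 ^ j - half_pow j))%N.
  by case: j {v0 p0} => [//|j] /=; rewrite expnS; lia.
pose c := Num.sqrt ((2 ^ j)%:R^-1 * var (2 ^ j) (2 ^ j.+1)).
have cE : dyadic j = (2 ^ j)%:R * c.
  by rewrite /c mulr_sqrtV// natrX.
have cl l : (half_pow j <= l < 2 ^ j)%N -> c <= Qterm l.
  move=> /andP[_ lj]; rewrite /c /Qterm ler_wsqrtr// ler_pM ?invr_ge0 ?ler0n//.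
    by rewrite lef_pV2 ?posrE ?ltr0n ?expn_gt0 ?ler_nat.
  rewrite (@remainder_split l (2 ^ j.+1)); last first.
    by apply: leq_trans lj _; rewrite leq_exp2l.
  rewrite (@var_cat _ _ l.+1 (2 ^ j) (2 ^ j.+1))//; last by rewrite leq_exp2l.
  by rewrite -addrA addrCA lerDl addr_ge0 ?var_ge0 ?remainder_ge0.
apply: le_trans (_ : 2 * \sum_(half_pow j <= l < 2 ^ j) c <= _); last first.
  by rewrite ler_wpM2l// ler_sum_nat.
rewrite cE sumr_const_nat -[c *+ _]mulr_natl mulrA ler_wpM2r ?sqrtr_ge0//.
by rewrite -natrM ler_nat.
Qed.

Lemma dyadic_sum_le_Q J : ((dyadic_sum J)%:E <= 2%:E * Q alpha)%E.
Proof.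
have h : dyadic_sum J <= 2 * \sum_(0 <= l < half_pow J) Qterm l.
  elim: J => [|J IH]; first by rewrite dyadic_sum0 big_geq// mulr0.
  rewrite dyadic_sumS.
  rewrite (@big_cat_nat _ _ _ (half_pow J))//=; last first.
    by case: J {IH} => [//|J] /=; rewrite leq_exp2l.
  by rewrite mulrDr lerD// dyadic_le_Qterm.
apply: le_trans (_ : (2 * \sum_(0 <= l < half_pow J) Qterm l)%:E <= _)%E.
  by rewrite lee_fin.
rewrite EFinM lee_wpmul2l// QE -sumEFin; apply: nneseries_lim_ge => l _ _.
by rewrite lee_fin Qterm_ge0.
Qed.

Lemma sqrtrD_le (a b : R) : 0 <= a -> 0 <= b ->
  Num.sqrt (a + b) <= Num.sqrt a + Num.sqrt b.
Proof.
move=> a0 b0; rewrite -[leRHS]ger0_norm ?addr_ge0 ?sqrtr_ge0// -sqrtr_sqr.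
rewrite ler_wsqrtr// sqrrD !sqr_sqrtr// addrAC lerDl.
by rewrite mulrn_wge0// mulr_ge0 ?sqrtr_ge0.
Qed.

Let rho J j := var (2 ^ j) (2 ^ J).

(** Splitting off one block gives [x j <= dyadic j + 3 / 4 * x j.+1], because
    [2 ^ (- 1 / 2) <= 3 / 4]; summed over [j], three quarters of the sum are absorbed
    by the left-hand side. *)
Lemma sqrt_rho J : \sum_(j < J) Num.sqrt (2 ^+ j) * Num.sqrt (rho J j) <= 4 * dyadic_sum J.
Proof.
pose x j := Num.sqrt (2 ^+ j) * Num.sqrt (rho J j) : R.
have x0 j : 0 <= x j by rewrite mulr_ge0 ?sqrtr_ge0.
have step j : (j < J)%N -> x j <= dyadic j + 3 / 4 * x j.+1.
  move=> jJ.
  have r1 : rho J j = var (2 ^ j) (2 ^ j.+1) + rho J j.+1.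
    by apply: var_cat; rewrite leq_exp2l.
  have r2 : Num.sqrt (rho J j) <= Num.sqrt (var (2 ^ j) (2 ^ j.+1)) + Num.sqrt (rho J j.+1).
    by rewrite r1 sqrtrD_le ?var_ge0.
  have r3 : Num.sqrt (2 ^+ j) <= 3 / 4 * Num.sqrt (2 ^+ j.+1) :> R.
    have -> : 3 / 4 = Num.sqrt ((3 / 4) ^+ 2) :> R by rewrite sqrtr_sqr ger0_norm.
    rewrite -sqrtrM ?sqr_ge0// ler_wsqrtr// [2 ^+ j.+1]exprS.
    have : 0 <= 2 ^+ j :> R by rewrite exprn_ge0.
    by set p := 2 ^+ j => p0; lra.
  apply: le_trans (ler_wpM2l (sqrtr_ge0 _) r2) _; rewrite mulrDr lerD2l /x mulrA.
  by rewrite ler_wpM2r ?sqrtr_ge0.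
have H : \sum_(j < J) x j <= dyadic_sum J + 3 / 4 * \sum_(j < J) x j.+1.
  rewrite mulr_sumr -big_split /=; apply: ler_sum => j _; exact: step.
have E : \sum_(j < J) x j.+1 = \sum_(j < J) x j + x J - x 0%N.
  have := big_ord_recl J (fun j : 'I_J.+1 => x j) (op := +%R) (idx := 0).
  by rewrite big_ord_recr /= => ->; rewrite addrC addrA addNr add0r.
have xJ : x J = 0 by rewrite /x /rho var_nil// sqrtr0 mulr0.
rewrite -/(\sum_(j < J) x j) in H *; rewrite E xJ addr0 in H.
have := x0 0%N; lra.
Qed.

(** The remainder after [l] is split at level [2 ^ J]: the finite part is treated by
    blocks, and what is left is small when [J] is large compared to [L]. *)
Lemma Qterm_sum_le J L : (L < 2 ^ J)%N ->
  \sum_(0 <= l < L) Qterm l <=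
  4 * dyadic_sum J + L%:R * Num.sqrt (remainder (2 ^ J).-1).
Proof.
move=> LJ; pose y l := Num.sqrt (l.+1%:R^-1 * var l.+1 (2 ^ J)) : R.
have Qy l : (l < 2 ^ J)%N -> Qterm l <= y l + Num.sqrt (remainder (2 ^ J).-1).
  move=> lJ; rewrite /Qterm (remainder_split lJ) mulrDr.
  apply: le_trans (sqrtrD_le _ _) _; rewrite ?mulr_ge0 ?invr_ge0 ?var_ge0 ?remainder_ge0//.
  rewrite lerD2l ler_wsqrtr// ler_piMl ?remainder_ge0//.
  by rewrite invf_le1 ?ltr0n// ler1n.
apply: le_trans (_ : \sum_(0 <= l < L) (y l + Num.sqrt (remainder (2 ^ J).-1)) <= _).
  by apply: ler_sum_nat => l /andP[_ lL]; apply: Qy; exact: ltn_trans LJ.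
rewrite big_split /= sumr_const_nat subn0 -[X in _ + X]mulr_natl lerD2r.
apply: le_trans (sqrt_rho J).
have y0 l : 0 <= y l by exact: sqrtr_ge0.
have blk K : (K <= J)%N -> \sum_(0 <= l < 2 ^ K - 1) y l <=
    \sum_(j < K) Num.sqrt (2 ^+ j) * Num.sqrt (rho J j).
  elim: K => [_|K IH KJ]; first by rewrite big_geq// big_ord0.
  have pK : (0 < 2 ^ K)%N by rewrite expn_gt0.
  have p0 : 0 < (2 ^ K)%:R :> R by rewrite ltr0n.
  rewrite (@big_cat_nat _ _ _ (2 ^ K - 1))//=; last by apply: leq_sub2r; rewrite leq_exp2l.
  rewrite big_ord_recr /= lerD ?IH//; first exact: ltnW.
  apply: le_trans (_ : \sum_(2 ^ K - 1 <= l < 2 ^ K.+1 - 1) Num.sqrt ((2 ^ K)%:R^-1 *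
    rho J K) <= _).
    apply: ler_sum_nat => l /andP[l1 l2]; have lK : (2 ^ K <= l.+1)%N by lia.
    rewrite /y ler_wsqrtr// ler_pM ?invr_ge0 ?ler0n ?var_ge0//.
      by rewrite lef_pV2 ?posrE ?ltr0n ?expn_gt0 ?ler_nat.
    rewrite /rho (@var_cat _ _ (2 ^ K) l.+1 (2 ^ J))// ?lerDr ?var_ge0//.
    have : (2 ^ K.+1 <= 2 ^ J)%N by rewrite leq_exp2l.
    lia.
  rewrite sumr_const_nat (_ : (2 ^ K.+1 - 1 - (2 ^ K - 1) = 2 ^ K)%N);
    last by rewrite expnS; lia.
  by rewrite -[Num.sqrt _ *+ _]mulr_natl mulr_sqrtV// natrX.
apply: le_trans (blk J _) => //.
rewrite (@big_cat_nat _ _ _ L 0 (2 ^ J - 1))//=; last lia.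
by rewrite lerDl; apply: sumr_ge0.
Qed.

Lemma Q_le_dyadic_sum M : (forall J, dyadic_sum J <= M) -> (Q alpha <= (4 * M)%:E)%E.
Proof.
move=> hM; rewrite QE; apply: lime_le.
  by apply: is_cvg_nneseries => l _ _; rewrite lee_fin Qterm_ge0.
near=> L; rewrite sumEFin lee_fin leNgt; apply/negP => lt_M.
set e := \sum_(0 <= l < L) Qterm l - 4 * M.
have e0 : 0 < e by rewrite subr_gt0.
pose dl := (e / (L%:R + 1)) ^+ 2.
have L1 : 0 < L%:R + 1 :> R by rewrite ltr_wpDl.
have dl0 : 0 < dl by rewrite exprn_gt0// divr_gt0.
have /cvgrPdist_lt/(_ _ dl0)[N _ hN] := remainder_cvg0.
pose J := maxn N L.
have J2 : (J < 2 ^ J)%N by exact: ltn_expl.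
have NJ : (N <= (2 ^ J).-1)%N by have := leq_maxl N L; rewrite -/J; lia.
have LJ : (L < 2 ^ J)%N by apply: leq_ltn_trans J2; exact: leq_maxr.
have := hN _ NJ; rewrite /= sub0r normrN ger0_norm ?remainder_ge0// => hr.
have hs : Num.sqrt (remainder (2 ^ J).-1) <= e / (L%:R + 1).
  rewrite -[leRHS]ger0_norm ?divr_ge0 ?(ltW e0) ?(ltW L1)// -sqrtr_sqr.
  by rewrite ler_wsqrtr// ltW.
have h1 := Qterm_sum_le LJ.
have h2 : L%:R * Num.sqrt (remainder (2 ^ J).-1) < e.
  apply: le_lt_trans (ler_wpM2l (ler0n R L) hs) _.
  by rewrite mulrA ltr_pdivrMr// mulrC ltr_pM2l// ltrDl.
have := hM J; rewrite /e in h2; lra.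
Unshelve. all: by end_near.
Qed.

End dyadic_series.

(** * Integrals of nonnegative functions without measurability *)

Section lower_integral.
Local Open Scope ereal_scope.
Context {d : measure_display} {X : measurableType d} {R : realType}.
Variable mu : {measure set X -> \bar R}.

(** The integral of a nonnegative function is the supremum of the integrals of the
    simple functions below it, hence monotone over arbitrary such functions. *)
Lemma ge0_le_integral_any (f g : X -> \bar R) :
  (forall x, 0 <= f x) -> (forall x, f x <= g x) ->
  \int[mu]_x f x <= \int[mu]_x g x.
Proof.
move=> f0 fg; have g0 x : 0 <= g x by apply: le_trans (fg x).
rewrite !ge0_integralTE//; apply: ereal_sup_le => _ [h hf <-].
by exists h => // x; apply: le_trans (fg x); exact: hf.
Qed.

Lemma markov_any (f : X -> \bar R) (x : R) (C : set X) : measurable C ->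
  (forall w, 0 <= f w) -> (0 <= x)%R -> (forall w, C w -> x%:E <= f w) ->
  x%:E * mu C <= \int[mu]_w f w.
Proof.
move=> mC f0 x0 Cf.
rewrite -[C in mu C]setIT -integral_indic// -ge0_integralZl//; last by apply/measurable_EFinP.
apply: ge0_le_integral_any => w; first by rewrite mule_ge0// lee_fin.
rewrite indicE; case: (boolP (w \in C)) => wC; last by rewrite mule0.
by rewrite mule1; apply: Cf; move: wC; rewrite inE.
Qed.

End lower_integral.

(** * From dyadic blocks to suprema over the boundary *)

Section assembly.
Local Open Scope ereal_scope.
Context {R : realType} {d : measure_display} {Omega : measurableType d}.
Variables (P : probability Omega R) (T : rooted_tree).
Variables (Z : T -> {RV P >-> R}) (alpha : nat -> R).
Hypothesis lf : locally_finite T.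
Hypothesis ll : leafless T.
Hypothesis Dmin_ge2 : 2%:E <= Dmin R T.
Hypothesis Dmax_fin : Dmax R T < +oo.
Hypothesis gZ : forall v, standard_gaussian (Z v).
Hypothesis indepZ : mutually_independent Z.
Hypothesis alpha_l2 : \sum_(1 <= k <oo) (alpha k ^+ 2)%:E < +oo.
Implicit Types (u v : T) (w : Omega) (xi : nat -> T).

Local Notation r := (Defs.root T).
Local Notation bsum := (bsum Z alpha).

Let D0 : R := fine (Dmin R T).
Let D1 : R := fine (Dmax R T).

Let Dmin_le u : Dmin R T <= (nb_children u)%:R%:E.
Proof. by apply: ereal_inf_lbound; exists u. Qed.

Let Dmax_ge u : (nb_children u)%:R%:E <= Dmax R T.
Proof. by apply: ereal_sup_ubound; exists u. Qed.

Let DminE : Dmin R T = D0%:E.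
Proof.
rewrite /D0 fineK// fin_numElt (lt_le_trans _ Dmin_ge2) ?ltNyr//=.
by apply: le_lt_trans (Dmin_le r) _; exact: ltry.
Qed.

Let DmaxE : Dmax R T = D1%:E.
Proof.
rewrite /D1 fineK// fin_numElt Dmax_fin andbT.
by apply: lt_le_trans (Dmax_ge r); exact: ltNyr.
Qed.

Let D0_ge2 : (2 <= D0)%R.
Proof. by rewrite -lee_fin -DminE. Qed.

Let D0_le u : (D0 <= (nb_children u)%:R)%R.
Proof. by rewrite -lee_fin -DminE. Qed.

Let D1_ge u : ((nb_children u)%:R <= D1)%R.
Proof. by rewrite -lee_fin -DmaxE. Qed.

Let D1_ge2 : (2 <= D1)%R.
Proof. exact: le_trans D0_ge2 (le_trans (D0_le r) (D1_ge r)). Qed.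

Let W := tail_weight alpha D1.
Let G := tail_envelope Z alpha D1.

Lemma boundary_nonempty : exists xi, boundary T xi.
Proof.
have [xi bxi _] := boundary_extend lf ll (u := r) (n := 0) (mem_head _ _).
by exists xi.
Qed.

Lemma block_bsum a b w xi : boundary T xi ->
  block Z alpha a b w xi = bsum a b.+1 (xi b) w.
Proof.
move=> bxi; apply: eq_big_nat => k /andP[_ kb].
by rewrite (boundary_anc lf bxi).
Qed.

Lemma ray_desc xi n : boundary T xi -> xi n \in desc r (level (xi n)).
Proof. by move=> bxi; rewrite (boundary_level lf n bxi); exact: boundary_desc. Qed.

Lemma block_chain J b w xi : boundary T xi ->
  (block Z alpha (2 ^ J) b w xi ^+ 2)%:E <= W J * G J w.
Proof.
move=> bxi; rewrite block_bsum// -{1}(boundary_level lf b bxi).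
by apply: chain_bound => //; exact: ray_desc.
Qed.

Lemma block_split a b c w xi : (a <= b.+1)%N -> (b <= c)%N ->
  block Z alpha a c w xi = (block Z alpha a b w xi + block Z alpha b.+1 c w xi)%R.
Proof. by move=> ab bc; rewrite /block -big_cat_nat. Qed.

Lemma block_empty a b w xi : (b < a)%N -> block Z alpha a b w xi = 0%R.
Proof. by move=> ba; rewrite /block big_geq. Qed.

(** Along a ray, everything beyond level [2 ^ J] is controlled by the same random
    quantity, uniformly in the ray. *)
Lemma Xn_chain J n w xi : boundary T xi -> (2 ^ J <= n.+1)%N ->
  ((Xn Z alpha w n xi - Xn Z alpha w (2 ^ J - 1) xi) ^+ 2)%:E <= W J * G J w.
Proof.
move=> bxi Jn; have J0 : (0 < 2 ^ J)%N by rewrite expn_gt0.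
rewrite /Xn (@block_split 1 (2 ^ J - 1) n)//; last lia.
rewrite addrAC subrr add0r subn1 prednK//; exact: block_chain.
Qed.

Lemma Mstar_ge w n xi : (1 <= n)%N -> boundary T xi ->
  `|Xn Z alpha w n xi|%:E <= Mstar Z alpha w.
Proof.
move=> n1 bxi; apply: le_trans (ereal_sup_ubound _); last by exists n.
by apply: ereal_sup_ubound; exists xi.
Qed.

Lemma Mstar_ge0 w : 0 <= Mstar Z alpha w.
Proof.
have [xi bxi] := boundary_nonempty; apply: le_trans (Mstar_ge w (leqnn 1) bxi).
by rewrite lee_fin.
Qed.

Lemma tail_sup2_ge N w n m xi : (1 <= n)%N -> (N <= n)%N -> boundary T xi ->
  (`|block Z alpha n (n + m) w xi| ^+ 2)%:E <= tail_sup2 Z alpha N w.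
Proof.
move=> n1 Nn bxi; apply: le_trans (ereal_sup_ubound _); last by exists n.
apply: le_trans (ereal_sup_ubound _); last by exists m.
by apply: ereal_sup_ubound; exists xi.
Qed.

Lemma tail_sup2_ge0 N w : 0 <= tail_sup2 Z alpha N w.
Proof.
have [xi bxi] := boundary_nonempty.
by apply: le_trans (@tail_sup2_ge N w N.+1 0 xi _ _ _) => //; rewrite lee_fin.
Qed.

Lemma Xinf_sup2_ge w xi : boundary T xi ->
  (`|Xinf Z alpha w xi| ^+ 2)%:E <= Xinf_sup2 Z alpha w.
Proof. by move=> bxi; apply: ereal_sup_ubound; exists xi. Qed.

Lemma Xinf_sup2_ge0 w : 0 <= Xinf_sup2 Z alpha w.
Proof.
have [xi bxi] := boundary_nonempty.
by apply: le_trans (Xinf_sup2_ge w bxi); rewrite lee_fin.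
Qed.

(** * Upper bounds and convergence *)

Let W_ge0 J : 0 <= W J. Proof. exact: tail_weight_ge0. Qed.
Let G_ge0 J w : 0 <= G J w. Proof. exact: tail_envelope_ge0. Qed.
Let WG_ge0 J w : 0 <= W J * G J w. Proof. by rewrite mule_ge0. Qed.
Let mG J : measurable_fun setT (G J). Proof. exact: measurable_tail_envelope. Qed.

Let WG_expectation J : \int[P]_w (W J * G J w) <= W J ^+ 2.
Proof.
rewrite ge0_integralZl// expe2 lee_pmul ?integral_ge0//.
exact: tail_envelope_expectation.
Qed.

Lemma Mstar_le w : Mstar Z alpha w ^+ 2 <= W 0 * G 0 w.
Proof.
have h : Mstar Z alpha w <= sqrte (W 0 * G 0 w).
  apply: ge_ereal_sup => _ [n _ <-]; apply: ge_ereal_sup => _ [xi bxi <-].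
  have -> : `|Xn Z alpha w n xi|%:E = sqrte (Xn Z alpha w n xi ^+ 2)%:E.
    by rewrite -sqrtr_sqr.
  rewrite lee_sqrt//; have := @Xn_chain 0 n w xi bxi.
  by rewrite expn0 subnn {2}/Xn block_empty// subr0; exact.
rewrite -(sqr_sqrte (WG_ge0 0 w)) !expe2.
by apply: lee_pmul => //; exact: Mstar_ge0.
Qed.

(** A block sum is the difference of two increments starting at level [2 ^ J]. *)
Lemma tail_sup2_le N J w : (2 ^ J <= N)%N ->
  tail_sup2 Z alpha N w <= 4%:E * (W J * G J w).
Proof.
move=> JN; apply: ge_ereal_sup => _ [n [n1 Nn] <-].
apply: ge_ereal_sup => _ [m _ <-]; apply: ge_ereal_sup => _ [xi bxi <-].
have h1 := block_chain J (n + m) w bxi; have h2 := block_chain J n.-1 w bxi.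
have -> : block Z alpha n (n + m) w xi =
    (block Z alpha (2 ^ J) (n + m) w xi - block Z alpha (2 ^ J) n.-1 w xi)%R.
  rewrite (@block_split (2 ^ J) n.-1 (n + m)); [|by rewrite prednK//; exact: leq_trans Nn|lia].
  by rewrite prednK// addrAC subrr add0r.
set x := block _ _ _ _ _ _ in h1 *; set y := block _ _ _ _ _ _ in h2 *.
apply: le_trans (_ : ((2 * x ^+ 2 + 2 * y ^+ 2)%R)%:E <= _).
  rewrite lee_fin real_normK ?num_real//.
  by have := sqr_ge0 (x + y); rewrite !sqrrD sqrrN; lra.
rewrite EFinD !EFinM.
apply: le_trans (leeD (lee_wpmul2l _ h1) (lee_wpmul2l _ h2)) _; rewrite ?lee_fin//.
rewrite -ge0_muleDl ?lee_fin// -EFinD.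
by rewrite (_ : (2 + 2 = 4 :> R)%R)//; ring.
Qed.

Let wr J : R := fine (W J).

Section summable.
Hypothesis Qfin : Q alpha < +oo.

Let qr : R := fine (Q alpha).

Let Q_ge0 : 0 <= Q alpha.
Proof. by apply: nneseries_ge0 => l _ _; exact: sqrte_ge0. Qed.

Let QE : Q alpha = qr%:E.
Proof. by rewrite /qr fineK// ge0_fin_numE. Qed.

Lemma tail_weight0_le : W 0 <= (2 * Num.sqrt 12 * Num.sqrt (ln D1))%:E * Q alpha.
Proof.
rewrite /W /tail_weight; apply: lime_le.
  by apply: is_cvg_nneseries => j _ _; rewrite lee_fin weight_ge0.
apply: nearW => n; rewrite sumEFin big_mkord.
rewrite (eq_bigr (fun j : 'I_n => (Num.sqrt (12 * ln D1) * dyadic alpha j)%R))//.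
rewrite -mulr_sumr -/(dyadic_sum alpha n) sqrtrM//.
have := dyadic_sum_le_Q alpha_l2 n; rewrite QE -!EFinM !lee_fin => h.
set a := (Num.sqrt 12 * Num.sqrt (ln D1))%R.
have -> : (2 * Num.sqrt 12 * Num.sqrt (ln D1) * qr = a * (2 * qr))%R by rewrite /a; ring.
by rewrite ler_wpM2l// mulr_ge0// sqrtr_ge0.
Qed.

Let W0_fin : W 0 < +oo.
Proof. by apply: le_lt_trans tail_weight0_le _; rewrite QE -EFinM ltry. Qed.

Let W_le0 J : W J <= W 0.
Proof.
rewrite {2}/W /tail_weight (nneseries_split _ J); last by move=> k _;
  rewrite lee_fin weight_ge0.
by rewrite add0n leeDr//; apply: sume_ge0 => j _; rewrite lee_fin weight_ge0.
Qed.

Lemma WE J : W J = (wr J)%:E.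
Proof. by rewrite /wr fineK// ge0_fin_numE//; exact: le_lt_trans W0_fin. Qed.

Lemma wr_ge0 J : (0 <= wr J)%R.
Proof. by rewrite -lee_fin -WE. Qed.

Lemma wr_small (e : R) : (0 < e)%R -> exists J0, forall J, (J0 <= J)%N -> (wr J <= e)%R.
Proof.
move=> e0; have := nneseries_tail_cvg W0_fin.
move=> /(_ _)/fine_cvgP[|_ /cvgrPdist_le/(_ _ e0)[J0 _ hJ]].
  by move=> j; rewrite lee_fin weight_ge0.
by exists J0 => J /hJ /=; rewrite sub0r normrN ger0_norm// wr_ge0.
Qed.

Let G_le0 J w : G J w <= G 0 w.
Proof.
have h k : 0 <= (envelope Z alpha D1 k w / weight alpha D1 k)%:E.
  by rewrite lee_fin divr_ge0 ?weight_ge0 ?envelope_ge0.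
rewrite {2}/G /tail_envelope (nneseries_split _ J)//.
by rewrite add0n leeDr//; apply: sume_ge0.
Qed.

Lemma cvg0_of_le (f : nat -> \bar R) : (forall N, 0 <= f N) ->
  (forall e : R, (0 < e)%R -> exists N0, forall N, (N0 <= N)%N -> f N <= e%:E) ->
  f N @[N --> \oo] --> 0.
Proof.
move=> f0 h; apply/fine_cvgP; split.
  have [N0 hN] := h _ ltr01; exists N0 => // N /= /hN fN.
  by rewrite ge0_fin_numE//; apply: le_lt_trans fN _; exact: ltry.
apply/cvgrPdist_le => e e0; have [N0 hN] := h _ e0.
exists N0 => // N /= /hN fN; rewrite sub0r normrN ger0_norm ?fine_ge0//.
rewrite -lee_fin fineK// ge0_fin_numE//; apply: le_lt_trans fN _; exact: ltry.
Qed.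

Lemma tails_vanish : tails_vanish_in_L2 Z alpha.
Proof.
apply: cvg0_of_le => [N|e e0]; first by apply: integral_ge0 => w _; exact: tail_sup2_ge0.
have d0 : (0 < Num.sqrt (e / 4))%R by rewrite sqrtr_gt0 divr_gt0.
have [J0 /(_ _ (leqnn J0)) hJ] := wr_small d0.
exists (2 ^ J0)%N => N JN.
apply: le_trans (_ : \int[P]_w (4%:E * (W J0 * G J0 w)) <= _).
  by apply: ge0_le_integral_any => w; [exact: tail_sup2_ge0|exact: tail_sup2_le].
rewrite ge0_integralZl//; last by apply: emeasurable_funM.
apply: le_trans (lee_wpmul2l _ (WG_expectation J0)) _; first by rewrite lee_fin.
rewrite WE -EFin_expe -EFinM lee_fin.
apply: le_trans (_ : (4 * Num.sqrt (e / 4) ^+ 2 <= _)%R).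
  by rewrite ler_wpM2l// lerXn2r ?nnegrE ?wr_ge0 ?sqrtr_ge0.
by rewrite sqr_sqrtr ?divr_ge0 ?(ltW e0)// mulrC divfK.
Qed.

Lemma G0_finite : {ae P, forall w, G 0 w < +oo}.
Proof.
have iG : P.-integrable setT (G 0).
  apply/integrableP; split; first exact: mG.
  under eq_integral do rewrite gee0_abs//.
  by apply: le_lt_trans W0_fin; exact: tail_envelope_expectation.
have := integrable_ae measurableT iG.
by apply: filterS => w /(_ I); rewrite ge0_fin_numE.
Qed.

Section convergence.
Variable w : Omega.
Hypothesis Gw : G 0 w < +oo.

Let gr J : R := fine (G J w).

Let GE J : G J w = (gr J)%:E.
Proof. by rewrite /gr fineK// ge0_fin_numE//; exact: le_lt_trans Gw. Qed.

Let gr_ge0 J : (0 <= gr J)%R.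
Proof. by rewrite -lee_fin -GE. Qed.

Let gr_le J : (gr J <= gr 0)%R.
Proof. by rewrite -lee_fin -!GE. Qed.

(** Bounds, along every ray, the distance from the partial sum before level [2 ^ J]
    to the limit ([Xinf_dist]). *)
Definition radius J : R := Num.sqrt (wr J * gr J).

Lemma radius2 J : (radius J ^+ 2)%:E = W J * G J w.
Proof. by rewrite WE GE -EFinM sqr_sqrtr// mulr_ge0// wr_ge0. Qed.

Lemma radius_small (e : R) : (0 < e)%R -> exists J, (radius J <= e)%R.
Proof.
move=> e0; have g1 : (0 < gr 0 + 1)%R by rewrite ltr_wpDl.
have d0 : (0 < e ^+ 2 / (gr 0 + 1))%R by rewrite divr_gt0// exprn_gt0.
have [J /(_ _ (leqnn J)) hJ] := wr_small d0; exists J.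
rewrite /radius -[leRHS]ger0_norm ?(ltW e0)// -sqrtr_sqr ler_wsqrtr//.
apply: le_trans (_ : (e ^+ 2 / (gr 0 + 1) * (gr 0 + 1) <= _)%R); last by rewrite divfK// gt_eqF.
apply: ler_pM => //; first exact: wr_ge0.
by apply: le_trans (gr_le J) _; rewrite lerDl.
Qed.

Lemma Xn_dist J n xi : boundary T xi -> (2 ^ J <= n.+1)%N ->
  (`|Xn Z alpha w n xi - Xn Z alpha w (2 ^ J - 1) xi| <= radius J)%R.
Proof.
move=> bxi Jn; have := @Xn_chain J n w xi bxi Jn.
rewrite -radius2 lee_fin -(ler_sqr _ (sqrtr_ge0 _)) ?nnegrE//.
by rewrite real_normK ?num_real.
Qed.

Lemma Xn_cvg xi : boundary T xi -> cvgn (fun n => Xn Z alpha w n xi).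
Proof.
move=> bxi; apply: cauchy_cvg; apply/cauchy_exP => e e0.
have [J hJ] := radius_small (divr_gt0 e0 (ltr0n R 2)).
exists (Xn Z alpha w (2 ^ J - 1) xi); exists (2 ^ J)%N => // n /= Jn.
rewrite /ball /= distrC; apply: le_lt_trans (Xn_dist bxi (leqW Jn)) _.
by apply: le_lt_trans hJ _; lra.
Qed.

Lemma Xinf_dist J xi : boundary T xi ->
  (`|Xinf Z alpha w xi - Xn Z alpha w (2 ^ J - 1) xi| <= radius J)%R.
Proof.
move=> bxi; have cX := Xn_cvg bxi; rewrite ler_distl; apply/andP; split.
  apply: limr_ge => //; exists (2 ^ J)%N => // n /= Jn.
  by have := Xn_dist bxi (leqW Jn); rewrite ler_distl => /andP[].
apply: limr_le => //; exists (2 ^ J)%N => // n /= Jn.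
by have := Xn_dist bxi (leqW Jn); rewrite ler_distl => /andP[].
Qed.

Lemma uniformly_convergent :
  {uniform boundary T, Xn Z alpha w n @[n --> \oo] --> Xinf Z alpha w}.
Proof.
move=> A /uniform_nbhs[E [entE sub]].
move: entE; rewrite -entourage_ballE => -[e /= e0 he].
have [J hJ] := radius_small (divr_gt0 e0 (ltr0n R 4)).
exists (2 ^ J)%N => // n /= Jn; apply: sub => xi bxi; apply: he.
rewrite /ball /=.
have h1 := Xinf_dist J bxi; have h2 := Xn_dist bxi (leqW Jn).
rewrite (_ : (_ - _ = (Xinf Z alpha w xi - Xn Z alpha w (2 ^ J - 1) xi) -
  (Xn Z alpha w n xi - Xn Z alpha w (2 ^ J - 1) xi))%R); last by ring.
apply: le_lt_trans (ler_normB _ _) _; lra.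
Qed.

End convergence.

(** Where [G 0 w] is infinite the limit along a ray may be meaningless, and the bound
    is trivial unless all weights vanish; in that case [G 0 w] vanishes too. *)
Lemma Xinf_sup2_le w : Xinf_sup2 Z alpha w <= W 0 * G 0 w.
Proof.
have [Gw|] := ltP (G 0 w) +oo.
  apply: ge_ereal_sup => _ [xi bxi <-]; rewrite -(radius2 Gw) lee_fin.
  rewrite lerXn2r ?nnegrE ?sqrtr_ge0//; have := Xinf_dist Gw 0 bxi.
  by rewrite expn0 subnn /Xn block_empty// subr0.
rewrite leye_eq => /eqP GE; rewrite GE.
have [W0|W0] := eqVneq (W 0) 0; last first.
  by rewrite gt0_muley ?leey// lt_neqAle eq_sym W0 W_ge0.
suff : G 0 w = 0 by rewrite GE.
apply: eseries0 => j _ _; suff -> : weight alpha D1 j = 0%R by rewrite invr0 mulr0.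
apply/eqP; rewrite eq_le weight_ge0 andbT -lee_fin.
apply: le_trans (_ : W 0 <= _); last by rewrite W0.
apply: le_trans (_ : \sum_(0 <= i < j.+1) (weight alpha D1 i)%:E <= _).
  rewrite big_nat_recr//= leeDr//; apply: sume_ge0 => i _.
  by rewrite lee_fin weight_ge0.
by apply: nneseries_lim_ge => i _ _; rewrite lee_fin weight_ge0.
Qed.

Lemma Qfin_uniform : as_uniformly_convergent Z alpha.
Proof.
apply: filterS G0_finite => w Gw; exists (Xinf Z alpha w).
exact: uniformly_convergent.
Qed.

Let upper (f : Omega -> \bar R) : (forall w, 0 <= f w) -> (forall w, f w <= W 0 * G 0 w) ->
  sqrte (\int[P]_w f w) <= (2 * Num.sqrt 12 * Num.sqrt (ln D1))%:E * Q alpha.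
Proof.
move=> f0 fWG; apply: le_trans tail_weight0_le.
rewrite -[W 0]gee0_abs// -sqrte_sqr lee_sqrt ?sqre_ge0//.
apply: le_trans (WG_expectation 0); exact: ge0_le_integral_any.
Qed.

Lemma Xinf_upper : sqrte (\int[P]_w Xinf_sup2 Z alpha w) <=
  (2 * Num.sqrt 12 * Num.sqrt (ln (fine (Dmax R T))))%:E * Q alpha.
Proof. by apply: upper => w; [exact: Xinf_sup2_ge0|exact: Xinf_sup2_le]. Qed.

Lemma Mstar_upper : sqrte (\int[P]_w Mstar Z alpha w ^+ 2) <=
  (2 * Num.sqrt 12 * Num.sqrt (ln (fine (Dmax R T))))%:E * Q alpha.
Proof.
by apply: upper => w; [rewrite expe2 mule_ge0 ?Mstar_ge0|exact: Mstar_le].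
Qed.

End summable.

(** * Lower bounds *)

Lemma measurable_list_le (us : seq T) (F : T -> Omega -> R) (x : R) :
  (forall u, measurable_fun setT (F u)) ->
  measurable [set w | forall u, u \in us -> (F u w <= x)%R].
Proof.
move=> mF; elim: us => [|u us IH].
  by rewrite (_ : [set w | _] = setT)//; apply/seteqP; split.
rewrite (_ : [set w | _] = F u @^-1` `]-oo, x] `&`
    [set w | forall u, u \in us -> (F u w <= x)%R]); last first.
  apply/seteqP; split => w /=.
    move=> h; split; first by rewrite in_itv/=; apply: h; rewrite mem_head.
    by move=> v vus; apply: h; rewrite inE vus orbT.
  move=> [h1 h2] v; rewrite inE => /orP[/eqP ->|]; last exact: h2.
  by move: h1; rewrite in_itv.
apply: measurableI => //; rewrite -[X in measurable X]setTI; exact: mF.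
Qed.

(** The small ball event, expressed by finitely many vertices and hence
    measurable. *)
Definition below J (x : R) : set Omega :=
  [set w | forall u, u \in desc r (2 ^ J - 1) -> (bsum 1 (2 ^ J) u w <= x)%R].

Lemma measurable_below J x : measurable (below J x).
Proof. by apply: measurable_list_le => u; exact: measurable_bsum. Qed.

Let kappa : R := (@spread_cst R * Num.sqrt (ln D0))%R.
Let q : R := @small_ball_cst R.

Let kappa_gt0 : (0 < kappa)%R.
Proof.
rewrite mulr_gt0//; first exact: spread_cst_gt0.
by rewrite sqrtr_gt0 ln_gt0//; apply: lt_le_trans D0_ge2; rewrite ltr1n.
Qed.

Let q_lt1 : (q < 1)%R.
Proof. exact: small_ball_cst_lt1. Qed.

Let q_ge0 : (0 <= q)%R. Proof. exact: expR_ge0. Qed.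

Local Notation S := (dyadic_sum alpha).

Lemma below_small J x : (0 < S J)%R -> (x <= kappa * S J)%R -> P (below J x) <= q%:E.
Proof.
move=> S0 xS; apply: (small_ball lf ll gZ indepZ D0_ge2 D0_le (measurable_below J x) S0 xS).
by move=> w u; apply.
Qed.

Lemma above_ray J x w : ~ below J x w ->
  exists2 xi, boundary T xi & (x < Xn Z alpha w (2 ^ J - 1) xi)%R.
Proof.
move=> /existsNP[u /not_implyP[ud /negP]]; rewrite -ltNge => xu.
have [xi bxi xiu] := boundary_extend lf ll ud; exists xi => //.
have J0 : (0 < 2 ^ J)%N by rewrite expn_gt0.
by rewrite /Xn block_bsum// xiu subn1 prednK.
Qed.

Lemma dyadic_sum_gt0_level J : (0 < S J)%R -> (1 <= 2 ^ J - 1)%N.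
Proof.
case: J => [|J]; first by rewrite dyadic_sum0 ltxx.
by move=> _; rewrite expnS; have := expn_gt0 2 J; lia.
Qed.

(** If [Q] is infinite then [S J] is unbounded, so by [below_small] the event that
    all [X_n] stay below [n] has probability at most [q < 1] for every [n]; but these
    events increase to one that contains almost every point where [M^*] is
    finite. *)
Lemma as_bounded_Qfin : as_bounded Z alpha -> Q alpha < +oo.
Proof.
move=> [N [mN PN sub]]; rewrite ltNge; apply/negP => Qoo.
have unb M : exists J, (M < S J)%R.
  apply: contrapT => h; have H : Q alpha <= (4 * M)%:E.
    apply: (Q_le_dyadic_sum alpha_l2) => J.
    by rewrite leNgt; apply/negP => MJ; apply: h; exists J.
  by have := le_trans Qoo H; rewrite leye_eq.
pose C n := \bigcap_J below J n%:R.
have mC n : measurable (C n) by apply: bigcapT_measurable => J; exact: measurable_below.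
have PC n : P (C n) <= q%:E.
  have [J hJ] := unb (n%:R / kappa)%R.
  have SJ : (0 < S J)%R by apply: le_lt_trans hJ; rewrite divr_ge0// ltW.
  apply: (@le_trans _ _ (P (below J n%:R))).
    by apply: le_measure; rewrite ?inE//; [exact: measurable_below|exact: bigcap_inf].
  apply: below_small => //; rewrite mulrC -ler_pdivrMr//; exact: ltW.
have mUC : measurable (\bigcup_n C n) by exact: bigcupT_measurable.
have ndC : nondecreasing_seq C.
  move=> m n mn; apply/subsetPset => w Cw J _ u ud.
  by apply: le_trans (Cw J I u ud) _; rewrite ler_nat.
have cvC := nondecreasing_cvg_mu (mu := P) mC mUC ndC.
have PUC : P (\bigcup_n C n) <= q%:E.
  rewrite -(cvg_lim _ cvC)//; apply: lime_le; first by apply/cvg_ex; eexists; exact: cvC.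
  by apply: nearW => n; exact: PC.
suff : 1 <= P (\bigcup_n C n).
  by move=> /le_trans/(_ PUC); rewrite lee_fin leNgt q_lt1.
have <- : P (~` N) = 1 by rewrite probability_setC// PN sube0.
apply: le_measure; rewrite ?inE//; first exact: measurableC.
move=> w /= Nw; have Mw : Mstar Z alpha w < +oo by apply: contrapT => h; apply: Nw; exact: sub.
have Mfin : Mstar Z alpha w \is a fin_num by rewrite ge0_fin_numE// Mstar_ge0.
exists (Num.truncn (fine (Mstar Z alpha w))).+1 => // J _;
  apply: contrapT => /above_ray[xi bxi].
set n := (2 ^ J - 1)%N => h.
have [n0|n0] := posnP n; first by move: h; rewrite n0 /Xn block_empty// ltNge ler0n.
have := Mstar_ge w n0 bxi; rewrite -(fineK Mfin) lee_fin.
have := truncnS_gt (fine (Mstar Z alpha w)).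
have := ler_norm (Xn Z alpha w n xi); lra.
Qed.

Lemma Mstar_second_moment J :
  ((kappa * S J) ^+ 2 * (1 - q))%:E <= \int[P]_w Mstar Z alpha w ^+ 2.
Proof.
have M0 w : 0 <= Mstar Z alpha w ^+ 2 by rewrite expe2 mule_ge0 ?Mstar_ge0.
have [S0|] := ltP 0%R (S J); last first.
  move=> S0; have -> : S J = 0%R by apply/eqP; rewrite eq_le S0 dyadic_sum_ge0.
  by rewrite mulr0 expr0n mul0r; exact: integral_ge0.
have x0 : (0 <= kappa * S J)%R by rewrite mulr_ge0// ltW.
apply: le_trans (_ : ((kappa * S J) ^+ 2)%:E * P (~` below J (kappa * S J)) <= _).
  rewrite probability_setC; last exact: measurable_below.
  rewrite EFinM lee_wpmul2l ?lee_fin ?sqr_ge0// EFinB leeB//.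
  exact: below_small.
apply: markov_any => //; first by apply: measurableC; exact: measurable_below.
  exact: sqr_ge0.
move=> w /above_ray[xi bxi h].
have := Mstar_ge w (dyadic_sum_gt0_level S0) bxi => hM.
rewrite EFin_expe !expe2; apply: lee_pmul; rewrite ?lee_fin//;
  by apply: le_trans hM; rewrite lee_fin; apply: le_trans (ltW h) (ler_norm _).
Qed.

(** With probability at least [1 - q] some ray exceeds [x] at level [2 ^ K - 1].
    For [K] large the rest of the series changes this by at most [x / 2], outside an
    event [Far] of probability at most [(1 - q) / 2]. *)
Lemma Xinf_second_moment J : Q alpha < +oo ->
  ((kappa * S J) ^+ 2 * ((1 - q) / 8))%:E <= \int[P]_w Xinf_sup2 Z alpha w.
Proof.
move=> Qfin.
have [S0|] := ltP 0%R (S J); last first.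
  move=> S0; have -> : S J = 0%R by apply/eqP; rewrite eq_le S0 dyadic_sum_ge0.
  rewrite mulr0 expr0n mul0r; apply: integral_ge0 => w _; exact: Xinf_sup2_ge0.
set x := (kappa * S J)%R.
have x0 : (0 < x)%R by rewrite mulr_gt0.
pose y := (x ^+ 2 / 4)%R; have y0 : (0 < y)%R by rewrite divr_gt0// exprn_gt0.
have e0 : (0 < y * ((1 - q) / 2))%R by rewrite mulr_gt0// divr_gt0// subr_gt0.
have sq0 : (0 < Num.sqrt (y * ((1 - q) / 2)))%R by rewrite sqrtr_gt0.
have [J0 hJ0] := wr_small Qfin sq0.
pose K := maxn J J0.
have SK : (S J <= S K)%R.
  rewrite /dyadic_sum -!(big_mkord xpredT (dyadic alpha)) (@big_cat_nat _ _ _ J 0 K)//=;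
    last exact: leq_maxl.
  by rewrite lerDl; apply: sumr_ge0 => j _; exact: dyadic_ge0.
have SK0 : (0 < S K)%R by exact: lt_le_trans SK.
pose Far := [set w | y%:E < W K * G K w].
have mWG : measurable_fun setT (fun w => W K * G K w) by apply: emeasurable_funM.
have mFar : measurable Far.
  rewrite /Far -[X in measurable X]setTI; exact: emeasurable_fun_o_infty.
have PFar : P Far <= ((1 - q) / 2)%:E.
  have : y%:E * P Far <= \int[P]_w (W K * G K w).
    by apply: markov_any => //; [exact: ltW|move=> w /ltW].
  move=> /le_trans/(_ (WG_expectation K)).
  rewrite -(fineK (fin_num_measure P Far mFar)) (WE Qfin) -EFin_expe -EFinM !lee_fin => h.
  rewrite -(ler_pM2l y0); apply: le_trans h _.
  apply: le_trans (_ : Num.sqrt (y * ((1 - q) / 2)) ^+ 2 <= _)%R;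
    last by rewrite sqr_sqrtr// ltW.
  rewrite lerXn2r ?nnegrE ?sqrtr_ge0 ?wr_ge0//; apply: hJ0; exact: leq_maxr.
have [N [mN PN subN]] := G0_finite Qfin.
pose Bad := (below K x `|` Far) `|` N.
have mB := measurable_below K x.
have mBad : measurable Bad by apply: measurableU => //; exact: measurableU.
have PBad : P Bad <= (q + (1 - q) / 2)%:E.
  apply: le_trans (measureU2 _ _ _) _ => //; first exact: measurableU.
  rewrite [X in _ + X]PN adde0; apply: le_trans (measureU2 _ _ _) _ => //.
  rewrite EFinD; apply: leeD => //; apply: below_small => //.
  by rewrite /x ler_wpM2l// ltW.
apply: le_trans (_ : y%:E * P (~` Bad) <= _).
  rewrite probability_setC// (_ : (x ^+ 2 * ((1 - q) / 8))%R = (y * (1 - (q + (1 - q) /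
    2)))%R); last first.
    by rewrite /y; field.
  rewrite EFinM lee_wpmul2l ?lee_fin ?(ltW y0)// EFinB; exact: leeB.
apply: markov_any; [exact: measurableC|exact: Xinf_sup2_ge0|exact: ltW|].
move=> w; rewrite /Bad !setCU => -[[/above_ray[xi bxi h] nF] nN].
have Gw : G 0 w < +oo by apply: contrapT => hG; apply: nN; exact: subN.
apply: le_trans (Xinf_sup2_ge w bxi); rewrite lee_fin.
have rK : (radius w K <= x / 2)%R.
  rewrite -(ler_sqr (sqrtr_ge0 _)) ?nnegrE ?divr_ge0 ?(ltW x0)// -lee_fin radius2//.
  apply: le_trans (_ : y%:E <= _); first by rewrite leNgt; apply/negP.
  by rewrite lee_fin /y; have -> : (x ^+ 2 / 4 = (x / 2) ^+ 2)%R by field.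
have := Xinf_dist Qfin Gw K bxi; rewrite ler_distl => /andP[h1 _].
have hx : (x / 2 <= Xinf Z alpha w xi)%R by lra.
rewrite /y (_ : (x ^+ 2 / 4 = (x / 2) ^+ 2)%R); last by field.
rewrite lerXn2r ?nnegrE ?divr_ge0 ?(ltW x0)//; exact: le_trans hx (ler_norm _).
Qed.

Lemma Q_lower (I : \bar R) (c : R) : (0 < c)%R -> 0 <= I ->
  (forall J, ((c * S J) ^+ 2)%:E <= I) -> (c / 4)%:E * Q alpha <= sqrte I.
Proof.
move=> c0 I0 hI; case: I I0 hI => [I| |] I0 hI //; last by rewrite leey.
have Qle := @Q_le_dyadic_sum _ alpha alpha_l2 (Num.sqrt I / c)%R.
apply: le_trans (_ : (c / 4)%:E * (4 * (Num.sqrt I / c))%:E <= _).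
  rewrite lee_wpmul2l ?lee_fin ?divr_ge0 ?(ltW c0)//; apply: Qle => J.
  rewrite ler_pdivlMr// mulrC -[leLHS]ger0_norm; last first.
    by rewrite mulr_ge0 ?(ltW c0) ?dyadic_sum_ge0.
  rewrite -sqrtr_sqr ler_wsqrtr//; have := hI J; by rewrite lee_fin.
rewrite -EFinM lee_fin; have -> // : (c / 4 * (4 * (Num.sqrt I / c)) = Num.sqrt I)%R.
by field; rewrite gt_eqF.
Qed.

Let lower (I : \bar R) : 0 <= I ->
  (forall J, ((kappa * S J) ^+ 2 * ((1 - q) / 8))%:E <= I) ->
  (@lower_cst R * Num.sqrt (ln D0))%:E * Q alpha <= sqrte I.
Proof.
move=> I0 hI; have q8 : (0 < (1 - q) / 8)%R by rewrite divr_gt0// subr_gt0.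
have -> : (@lower_cst R * Num.sqrt (ln D0) = kappa * Num.sqrt ((1 - q) / 8) / 4)%R.
  by rewrite /lower_cst /kappa /q; ring.
apply: Q_lower => //; first by rewrite mulr_gt0// sqrtr_gt0.
move=> J; apply: le_trans (hI J); rewrite lee_fin mulrAC exprMn.
by rewrite sqr_sqrtr// ltW.
Qed.

Lemma Mstar_lower : (@lower_cst R * Num.sqrt (ln (fine (Dmin R T))))%:E * Q alpha <=
  sqrte (\int[P]_w Mstar Z alpha w ^+ 2).
Proof.
apply: lower => [|J].
  by apply: integral_ge0 => w _; rewrite expe2 mule_ge0 ?Mstar_ge0.
apply: le_trans (Mstar_second_moment J); rewrite lee_fin ler_wpM2l ?sqr_ge0//.
by have := q_lt1; lra.
Qed.

Lemma Xinf_lower : Q alpha < +oo ->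
  (@lower_cst R * Num.sqrt (ln (fine (Dmin R T))))%:E * Q alpha <=
  sqrte (\int[P]_w Xinf_sup2 Z alpha w).
Proof.
move=> Qfin; apply: lower => [|J]; last exact: Xinf_second_moment.
by apply: integral_ge0 => w _; exact: Xinf_sup2_ge0.
Qed.

(** * Boundedness from convergence *)

Let level_bound w n : R := (\sum_(u <- desc r n) `|bsum 1 n.+1 u w|)%R.

Let level_boundP w n xi : boundary T xi -> (`|Xn Z alpha w n xi| <= level_bound w n)%R.
Proof.
move=> bxi; rewrite /Xn block_bsum//.
by apply: (le_sum_mem (F := fun u => `|bsum 1 n.+1 u w|%R)) => //; exact: boundary_desc.
Qed.

(** The first [n0] levels contain finitely many vertices, so a uniform bound on the
    later increments suffices. *)
Lemma Mstar_finite w n0 (c : R) :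
  (forall n xi, (n0 <= n)%N -> boundary T xi ->
     (`|Xn Z alpha w n xi - Xn Z alpha w n0 xi| <= c)%R) ->
  Mstar Z alpha w < +oo.
Proof.
move=> h; have c0 : (0 <= c)%R.
  have [xi bxi] := boundary_nonempty; apply: le_trans (h n0 xi (leqnn _) bxi); exact: normr_ge0.
pose B := (\sum_(n < n0.+1) level_bound w n + c)%R.
have lb0 n : (0 <= level_bound w n)%R by apply: sumr_ge0.
have lbB n : (n <= n0)%N -> (level_bound w n <= \sum_(n < n0.+1) level_bound w n)%R.
  move=> nn0; rewrite (bigD1 (Ordinal (nn0 : (n < n0.+1)%N)))//= lerDl.
  exact: sumr_ge0.
apply: le_lt_trans (ltry B); apply: ge_ereal_sup => _ [n _ <-].
apply: ge_ereal_sup => _ [xi bxi <-]; rewrite lee_fin /B.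
have [nn0|/ltnW n0n] := leqP n n0.
  by have := level_boundP w n bxi; have := lbB n nn0; lra.
have h1 := h n xi n0n bxi; have h2 := level_boundP w n0 bxi; have h3 := lbB _ (leqnn n0).
have := ler_normD (Xn Z alpha w n xi - Xn Z alpha w n0 xi)%R (Xn Z alpha w n0 xi).
rewrite subrK; lra.
Qed.

Lemma uniform_as_bounded : as_uniformly_convergent Z alpha -> as_bounded Z alpha.
Proof.
apply: filterS => w [f cvf].
have : nbhs (f : {uniform` boundary T -> R}) [set h | forall xi, boundary T xi -> ball
  (f xi) 1 (h xi)].
  apply/uniform_nbhs; exists [set xy | ball xy.1 1 xy.2]; split => //.
  exact: entourage_ball (PosNum ltr01).
move=> /cvf[n0 _ hn0]; apply: (@Mstar_finite w n0 2%R) => n xi n0n bxi.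
have h1 := hn0 _ n0n xi bxi; have h2 := hn0 _ (leqnn n0) xi bxi.
rewrite /ball /= in h1 h2.
rewrite (_ : (_ - _ = (f xi - Xn Z alpha w n0 xi) - (f xi - Xn Z alpha w n xi))%R);
  last by ring.
apply: le_trans (ler_normB _ _) _; lra.
Qed.

(** Markov's inequality applied to the largest squared increment beyond level [N];
    the exceptional set is a countable intersection of events on finitely many
    vertices each. *)
Lemma tails_as_bounded : tails_vanish_in_L2 Z alpha -> as_bounded Z alpha.
Proof.
move=> tv.
have [N N1 hN] : exists2 N, (1 <= N)%N & \int[P]_w tail_sup2 Z alpha N w <= 1.
  have /fine_cvgP[[N0 _ h0] /cvgrPdist_le/(_ _ ltr01)[N2 _ h2]] := tv.
  pose N := (maxn N0 N2).+1; exists N => //.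
  have fN := h0 N (leqW (leq_maxl _ _)).
  have := h2 N (leqW (leq_maxr _ _)).
  rewrite /= sub0r normrN -(fineK fN) lee_fin; apply: le_trans; exact: ler_norm.
pose C n := \bigcap_m [set w | forall u, u \in desc r (N + m) ->
  (bsum N (N + m).+1 u w ^+ 2 <= n%:R)%R].
have mC n : measurable (C n).
  apply: bigcapT_measurable => m; apply: (@measurable_list_le _ (fun u w => (bsum N (N
    + m).+1 u w ^+ 2)%R)) => u.
  by apply: measurable_funX; exact: measurable_bsum.
have mB : measurable (\bigcap_n ~` C n) by apply: bigcapT_measurable => n; exact: measurableC.
exists (\bigcap_n ~` C n); split => //.
  apply/eqP; rewrite eq_le measure_ge0 andbT; apply/lee_addgt0Pr => e e0; rewrite add0e.
  pose n := (Num.truncn (e^-1)).+1.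
  have ne : (1 <= n%:R * e)%R.
    by rewrite -ler_pdivrMr// mul1r ltW// truncnS_gt.
  apply: (@le_trans _ _ (P (~` C n))).
    apply: le_measure; rewrite ?inE//; first exact: measurableC.
    by move=> w; apply.
  have h : n%:R%:E * P (~` C n) <= 1.
    apply: le_trans hN; apply: markov_any => //; first exact: measurableC.
      by move=> w; exact: tail_sup2_ge0.
    move=> w /existsNP[m /not_implyP[_ /existsNP[u /not_implyP[ud /negP]]]].
    rewrite -ltNge => nu; have [xi bxi xiu] := boundary_extend lf ll ud.
    apply: le_trans (@tail_sup2_ge N w N m xi N1 (leqnn N) bxi).
    by rewrite lee_fin real_normK ?num_real// block_bsum// xiu ltW.
  have mCn := measurableC (mC n).
  rewrite -(fineK (fin_num_measure P _ mCn)) -EFinM !lee_fin in h *.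
  have n0 : (0 < n%:R :> R)%R by rewrite ltr0n.
  by rewrite -(ler_pM2l n0); apply: le_trans h ne.
move=> w /= hw; apply: contrapT => nw; apply: hw.
have [n Cn] : exists n, C n w.
  by apply: contrapT => h; apply: nw => n _ Cn; apply: h; exists n.
apply: (@Mstar_finite w N.-1 (n%:R + 1)%R) => k xi Nk bxi.
have [kN|] := eqVneq k N.-1.
  by rewrite kN subrr normr0 addr_ge0.
move=> kN; have {kN} Nk' : (N <= k)%N by lia.
rewrite /Xn (@block_split 1 N.-1 k)//.
rewrite addrAC subrr add0r prednK// block_bsum//.
have := Cn (k - N)%N I (xi k); rewrite subnKC// => /(_ (boundary_desc lf k bxi)).
set y := bsum _ _ _ _ => hy.
rewrite -[(y ^+ 2)%R]real_normK ?num_real// in hy.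
by have := sqr_ge0 (`|y| - 1)%R; have := sqr_ge0 `|y|%R; move: hy; nra.
Qed.

Lemma equivalences : [<-> as_bounded Z alpha; tails_vanish_in_L2 Z alpha;
  as_uniformly_convergent Z alpha; Q alpha < +oo].
Proof.
tfae.
- by move=> /as_bounded_Qfin/tails_vanish.
- by move=> /tails_as_bounded/as_bounded_Qfin/Qfin_uniform.
- by move=> /uniform_as_bounded/as_bounded_Qfin.
- by move=> /Qfin_uniform/uniform_as_bounded.
Qed.

End assembly.

Theorem theorem1p1 (R : realType) :
  exists c1 c2 : R, [/\ 0 < c1, 0 < c2 &
    forall (T : rooted_tree)
      (d : measure_display) (Omega : measurableType d) (P : probability Omega R)
      (Z : T -> {RV P >-> R}) (alpha : nat -> R),
    locally_finite T -> leafless T ->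
    (2%:E <= Dmin R T)%E -> (Dmax R T < +oo)%E ->
    (forall v : T, standard_gaussian (Z v)) -> mutually_independent Z ->
    (\sum_(1 <= k <oo) (alpha k ^+ 2)%:E < +oo)%E ->
    [<-> as_bounded Z alpha;
         tails_vanish_in_L2 Z alpha;
         as_uniformly_convergent Z alpha;
         (Q alpha < +oo)%E] /\
    ([\/ as_bounded Z alpha, tails_vanish_in_L2 Z alpha,
         as_uniformly_convergent Z alpha | (Q alpha < +oo)%E] ->
     [/\ ((c1 * Num.sqrt (ln (fine (Dmin R T))))%:E * Q alpha
            <= sqrte (\int[P]_omega Xinf_sup2 Z alpha omega))%E,
         (sqrte (\int[P]_omega Xinf_sup2 Z alpha omega)
            <= (c2 * Num.sqrt (ln (fine (Dmax R T))))%:E * Q alpha)%E,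
         ((c1 * Num.sqrt (ln (fine (Dmin R T))))%:E * Q alpha
            <= sqrte (\int[P]_omega Mstar Z alpha omega ^+ 2))%E &
         (sqrte (\int[P]_omega Mstar Z alpha omega ^+ 2)
            <= (c2 * Num.sqrt (ln (fine (Dmax R T))))%:E * Q alpha)%E])].
Proof.
exists (@lower_cst R), (2 * Num.sqrt 12); split.
- exact: lower_cst_gt0.
- by rewrite mulr_gt0// sqrtr_gt0.
move=> T d Omega P Z alpha lf ll D2 Doo gZ indepZ l2.
have eqv := equivalences lf ll D2 Doo gZ indepZ l2; split; first exact: eqv.
move=> cond; have Qfin : (Q alpha < +oo)%E.
  by case: cond => [/(eqv 0 3)|/(eqv 1 3)|/(eqv 2 3)|].
split.
- exact: (Xinf_lower lf ll D2 Doo gZ indepZ l2 Qfin).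
- exact: (Xinf_upper lf ll D2 Doo gZ indepZ l2 Qfin).
- exact: (Mstar_lower lf ll D2 Doo gZ indepZ l2).
- exact: (Mstar_upper lf ll D2 Doo gZ indepZ l2 Qfin).
Qed.
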